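(* Let $d\ge 6$ be an integer, and let $G$ be a vertex transitive subgroup of the universal group $U=U(\mathrm{Alt}_{2d-1})\le \mathrm{Aut}(X_{O_d})$. Then the following are equivalent: (1) $G$ is dense in $U$. (2) $G$ is non-discrete and $G_v|_{\mathcal B_1(v)}=U_v|_{\mathcal B_1(v)}$ for some vertex $v$ of $X_{O_d}$. (3) $G_v|_{\mathcal B_2(v)}=U_v|_{\mathcal B_2(v)}$ for some vertex $v$ of $X_{O_d}$.
   Context: The Odd graph $O_d$ has as vertices the subsets of $[2d-1]=\{1,\dots,2d-1\}$ of size $d-1$, two being adjacent iff disjoint. $\mathrm{Aut}(O_d)=\mathrm{Sym}_{2d-1}$, and $\mathrm{Alt}_{2d-1}\le \mathrm{Aut}(O_d)$ is the alternating group. For a finite triangle-free graph $L$ (such as $L=O_d$), $W_L=\langle V(L)\mid a^2\ (a\in V(L)),\ [a,b]\ (\{a,b\}\in E(L))\rangle$, and the Davis complex $X_L$ is the CAT(0) square complex with vertex set $W_L$, an edge labelled $a$ joining $g$ and $ga$ for every $g\in W_L$, $a\in V(L)$, and a square for every coset $g\langle a,b\rangle$ with $\{a,b\}\in E(L)$. The labels identify the link of each vertex $v$ with $L$, via $c_v:\mathrm{Lk}(v,X_L)\to L$. $\mathrm{Aut}(X_L)$ is the group of cellular automorphisms with the topology of pointwise convergence. For $g\in\mathrm{Aut}(X_L)$ and a vertex $v$, the local action of $g$ at $v$ is $\mathbf D_vg=c_{gv}\circ \mathbf d_vg\circ c_v^{-1}\in\mathrm{Aut}(L)$, where $\mathbf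 d_vg:\mathrm{Lk}(v,X_L)\to\mathrm{Lk}(gv,X_L)$ is the map induced by $g$. For $F\le\mathrm{Aut}(L)$ the universal group is $U(F)=\{g\in\mathrm{Aut}(X_L)\mid \mathbf D_vg\in F\text{ for every vertex }v\}$. $\mathcal B_n(v)$ is the ball of radius $n$ around the vertex $v$ in the $\ell_\infty$ metric on vertices: the distance between two vertices is the least $n$ such that there is a sequence of $n+1$ vertices between them in which consecutive vertices lie in a common closed cube. $H_v$ is the stabilizer of $v$ in $H$, and $H|_A$ is the group of permutations obtained by restricting the elements of $H$ to the $H$-invariant set $A$. ''Vertex transitive'' means transitive on the vertices of $X_{O_d}$. *)

(* Defs.v *)
From HB Require Import structures.
From mathcomp Require Import all_boot all_fingroup all_solvable.
From mathcomp Require Import generic_quotient.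
From mathcomp Require Import all_classical.
From mathcomp Require Import topology.

Set Implicit Arguments.
Unset Strict Implicit.
Unset Printing Implicit Defensive.

Local Open Scope quotient_scope.
Local Open Scope group_scope.

Section OddGraph.
Variable d : nat.

Definition odd_vertex : Type := {A : {set 'I_(2 * d - 1)} | #|A| == (d - 1)%N}.
HB.instance Definition _ := Finite.on odd_vertex.

Definition odd_adj : rel odd_vertex := fun A B => [disjoint val A & val B].

Lemma odd_act_proof (s : 'S_(2 * d - 1)) (A : odd_vertex) :
  #|s @: val A| == (d - 1)%N.
Proof. by rewrite card_imset ?(valP A) //; exact: perm_inj. Qed.

Definition odd_act (s : 'S_(2 * d - 1)) (A : odd_vertex) : odd_vertex :=
  Sub (s @: val A) (odd_act_proof s A).

Lemma odd_act_inj s : injective (odd_act s).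
Proof.
move=> A B /(congr1 val) /= sAB; apply: val_inj.
exact: imset_inj (@perm_inj _ s) _ _ sAB.
Qed.

Lemma odd_act_adj s A B : odd_adj (odd_act s A) (odd_act s B) = odd_adj A B.
Proof.
rewrite /odd_adj /= -!setI_eq0 -imsetI ?imset_eq0 //.
by move=> x y _ _; exact: perm_inj.
Qed.

Definition odd_perm_of (s : 'S_(2 * d - 1)) : {perm odd_vertex} :=
  perm (@odd_act_inj s).

Definition odd_Alt : {set {perm odd_vertex}} :=
  [set odd_perm_of s | s in 'Alt_('I_(2 * d - 1))].

End OddGraph.

Local Open Scope classical_set_scope.

Section RightAngledCoxeterGroup.
Variables (V : finType) (E : rel V).

(* W_L for the graph L = (V, E), as a quotient of the set of words in V: since *)
(* a * a is a relator, inverse letters are not needed, and the relator [a, b]  *)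
(* reads a b a b. The lemmas [racg_relations] and [racg_universal] show that   *)
(* the quotient is the group with the given presentation.                      *)
Inductive racg_eqv : seq V -> seq V -> Prop :=
| racg_refl u : racg_eqv u u
| racg_sym u v : racg_eqv u v -> racg_eqv v u
| racg_trans u v w : racg_eqv u v -> racg_eqv v w -> racg_eqv u w
| racg_cat u u' v v' :
    racg_eqv u u' -> racg_eqv v v' -> racg_eqv (u ++ v) (u' ++ v')
| racg_sq a : racg_eqv [:: a; a] [::]
| racg_comm a b : E a b -> racg_eqv [:: a; b; a; b] [::].

Definition racg_eqvb (u v : seq V) : bool := `[< racg_eqv u v >].

Lemma racg_eqvb_refl : reflexive racg_eqvb.
Proof. by move=> u; apply/asboolP; exact: racg_refl. Qed.

Lemma racg_eqvb_sym : symmetric racg_eqvb.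
Proof. by move=> u v; apply/asboolP/asboolP; exact: racg_sym. Qed.

Lemma racg_eqvb_trans : transitive racg_eqvb.
Proof.
by move=> v u w /asboolP uv /asboolP vw; apply/asboolP; exact: racg_trans uv vw.
Qed.

Canonical racg_equiv :=
  EquivRel racg_eqvb racg_eqvb_refl racg_eqvb_sym racg_eqvb_trans.

Definition racg : Type := {eq_quot racg_equiv}.
HB.instance Definition _ := Choice.on racg.
HB.instance Definition _ := EqQuotient.on racg.

Definition racg_word (u : seq V) : racg := \pi_racg u.
Definition racg_gen (a : V) : racg := racg_word [:: a].

Lemma racg_wordP u v : racg_word u = racg_word v <-> racg_eqv u v.
Proof.
split=> [/eqP|uv]; first by rewrite eqmodE => /asboolP.
by apply/eqP; rewrite eqmodE; apply/asboolP.
Qed.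

Lemma racg_word_ind (P : racg -> Prop) :
  (forall u, P (racg_word u)) -> forall x, P x.
Proof. by move=> Pw x; rewrite -[x]reprK; exact: Pw. Qed.

Lemma racg_reprK u : racg_eqv (repr (racg_word u)) u.
Proof. by apply/racg_wordP; exact: reprK. Qed.

Lemma racg_rev u v : racg_eqv u v -> racg_eqv (rev u) (rev v).
Proof.
elim=> {u v} [w|w w' _|w1 w2 w3 _ h1 _ h2|w1 w2 w3 w4 _ h1 _ h2|a|a b ab].
- exact: racg_refl.
- exact: racg_sym.
- exact: racg_trans h1 h2.
- by rewrite !rev_cat; exact: racg_cat.
- exact: racg_sq.
- rewrite /rev /=; apply: racg_trans (racg_sq a).
  apply: racg_trans (_ : racg_eqv ([:: a] ++ [:: a; b; a; b] ++ [:: a]) _).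
    exact: racg_cat (racg_sym (racg_sq a)) (racg_refl [:: b; a; b; a]).
  apply: racg_cat (racg_refl [:: a]) _.
  exact: racg_cat (racg_comm ab) (racg_refl [:: a]).
Qed.

Lemma racg_rev_cat u : racg_eqv (rev u ++ u) [::].
Proof.
elim: u => [|a u IHu]; first exact: racg_refl.
rewrite rev_cons -cats1 -catA; apply: racg_trans IHu.
apply: racg_cat (racg_refl _) _.
exact: racg_cat (racg_sq a) (racg_refl u).
Qed.

Definition racg_mul (x y : racg) : racg := racg_word (repr x ++ repr y).
Definition racg_inv (x : racg) : racg := racg_word (rev (repr x)).

Lemma racg_mulE u v : racg_mul (racg_word u) (racg_word v) = racg_word (u ++ v).
Proof. by apply/racg_wordP; apply: racg_cat; exact: racg_reprK. Qed.

Lemma racg_invE u : racg_inv (racg_word u) = racg_word (rev u).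
Proof. by apply/racg_wordP/racg_rev/racg_reprK. Qed.

Lemma racg_mulA : associative racg_mul.
Proof.
elim/racg_word_ind=> u; elim/racg_word_ind=> v; elim/racg_word_ind=> w.
by rewrite !racg_mulE catA.
Qed.

Lemma racg_mul1 : left_id (racg_word [::]) racg_mul.
Proof. by elim/racg_word_ind=> u; rewrite racg_mulE. Qed.

Lemma racg_1mul : right_id (racg_word [::]) racg_mul.
Proof. by elim/racg_word_ind=> u; rewrite racg_mulE cats0. Qed.

Lemma racg_mulV : left_inverse (racg_word [::]) racg_inv racg_mul.
Proof.
elim/racg_word_ind=> u; rewrite racg_invE racg_mulE.
exact/racg_wordP/racg_rev_cat.
Qed.

Lemma racg_Vmul : right_inverse (racg_word [::]) racg_inv racg_mul.
Proof.
elim/racg_word_ind=> u; rewrite racg_invE racg_mulE.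
by apply/racg_wordP; rewrite -{1}[u]revK; exact: racg_rev_cat.
Qed.

HB.instance Definition _ :=
  isGroup.Build racg racg_mulA racg_mul1 racg_1mul racg_mulV racg_Vmul.

Lemma racg_wordM u v : racg_word (u ++ v) = racg_word u * racg_word v.
Proof. by rewrite -[LHS]racg_mulE. Qed.

Lemma racg_gen_sq a : racg_gen a * racg_gen a = 1.
Proof. by rewrite -racg_wordM; apply/racg_wordP; exact: racg_sq. Qed.

Lemma racg_relations :
  (forall a, racg_gen a ^+ 2 = 1) /\
  (forall a b, E a b -> [~ racg_gen a, racg_gen b] = 1).
Proof.
split=> [a|a b ab]; first by rewrite expgS expg1 racg_gen_sq.
have gV c : (racg_gen c)^-1 = racg_gen c.
  by rewrite -[LHS]mulg1 -(racg_gen_sq c) mulKg.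
have <- : racg_word [:: a; b; a; b] = 1 by exact/racg_wordP/racg_comm.
rewrite commgEl conjgE !gV (racg_wordM [:: a] [:: b; a; b]).
by rewrite (racg_wordM [:: b] [:: a; b]) (racg_wordM [:: a] [:: b]).
Qed.

Lemma racg_universal (H : groupType) (f : V -> H) :
    (forall a, f a ^+ 2 = 1) -> (forall a b, E a b -> [~ f a, f b] = 1) ->
  exists! phi : racg -> H,
    {morph phi : x y / x * y} /\ (forall a, phi (racg_gen a) = f a).
Proof.
move=> fsq fcomm; pose F u := \prod_(a <- u) f a.
have fV a : (f a)^-1 = f a.
  by rewrite -[LHS]mulg1 -(fsq a) expgS expg1 mulKg.
have Feqv u v : racg_eqv u v -> F u = F v.
  elim=> {u v} [//|//|w1 w2 w3 _ -> _ -> //|w1 w2 w3 w4 _ h1 _ h2|a|a b ab].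
  - by rewrite /F !big_cat /=; congr (_ * _).
  - by rewrite /F !big_cons big_nil mulg1 -(fsq a) expgS expg1.
  - rewrite /F !big_cons big_nil mulg1 -(fcomm a b ab) commgEl conjgE !fV.
    by [].
exists (fun x => F (repr x)); split; first split.
- elim/racg_word_ind=> u; elim/racg_word_ind=> v.
  rewrite -racg_wordM !(Feqv _ _ (racg_reprK _)).
  by rewrite /F big_cat.
- by move=> a; rewrite (Feqv _ _ (racg_reprK _)) /F big_seq1.
move=> phi [phiM phig]; apply/funext; elim/racg_word_ind=> u.
rewrite (Feqv _ _ (racg_reprK _)).
elim: u => [|a u IHu]; rewrite /F ?big_nil ?big_cons.
  have /eqP := phiM 1 1; rewrite mulg1 -{1}[phi 1]mulg1 => /eqP /mulgI.
  by move=> <-.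
by rewrite -cat1s racg_wordM phiM phig -IHu.
Qed.

Lemma racg_gen_inj : injective racg_gen.
Proof.
have par u v : racg_eqv u v -> forall c, odd (count_mem c u) = odd (count_mem c v).
  elim=> {u v} [//|//|w1 w2 w3 _ h1 _ h2 c|w1 w2 w3 w4 _ h1 _ h2 c|a c|a b _ c].
  - by rewrite h1.
  - by rewrite !count_cat !oddD h1 h2.
  - by rewrite /=; case: (a == c).
  - by rewrite /=; case: (a == c); case: (b == c).
move=> a b /racg_wordP /par /(_ b) /=; rewrite eqxx !addn0.
by case: eqP.
Qed.

End RightAngledCoxeterGroup.

(* The cells of dimension 1 and 2 of the Davis complex X_L are identified with *)
(* their sets of vertices, and a cellular automorphism of X_L with the         *)
(* permutation of the vertex set W_L that it induces.                          *)
Section DavisComplex.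
Variables (V : finType) (E : rel V).
Local Notation W := (racg E).
Local Notation gen := (@racg_gen V E).

Definition davis_edge (v : W) (a : V) : set W := [set v; v * gen a].

Definition davis_square (v : W) (a b : V) : set W :=
  [set v; v * gen a; v * gen b; v * gen a * gen b].

Definition is_edge (C : set W) : Prop := exists v a, C = davis_edge v a.

Definition is_square (C : set W) : Prop :=
  exists v a b, E a b /\ C = davis_square v a b.

Definition is_cube (C : set W) : Prop :=
  [\/ exists v, C = [set v], is_edge C | is_square C].

Definition davis_aut : set (W -> W) :=
  [set g | [/\ bijective g,
               forall C, is_edge C <-> is_edge (g @` C) &
               forall C, is_square C <-> is_square (g @` C)]].

(* The chart c_v; a vertex of Lk(v, X_L) is an edge of X_L containing v, and   *)
(* [davis_edge v] is the inverse of c_v.                                       *)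
Definition link_chart (v : W) (e : set W) : option V :=
  [pick a | `[< e = davis_edge v a >]].

(* The local action D_v g = c_(g v) o d_v g o c_v^-1. It is well defined when  *)
(* g is a cellular automorphism, see [local_actionP].                          *)
Definition local_action (g : W -> W) (v : W) : {perm V} :=
  odflt 1 [pick s : {perm V} |
    [forall a, link_chart (g v) (g @` davis_edge v a) == Some (s a)]].

Definition universal_group (F : {set {perm V}}) : set (W -> W) :=
  [set g | davis_aut g /\ forall v, local_action g v \in F].

Lemma davis_edge_inj (v : W) : injective (davis_edge v).
Proof.
move=> a b eab.
have ne1 c : v * gen c <> v.
  rewrite -[X in _ = X]mulg1 => /mulgI /racg_wordP.
  have par u w : racg_eqv E u w -> odd (size u) = odd (size w).
    elim=> {u w} [//|//|w1 w2 w3 _ -> _ -> //|w1 w2 w3 w4 _ h1 _ h2|//|//].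
    by rewrite !size_cat !oddD h1 h2.
  by move/par.
have : davis_edge v b (v * gen a) by rewrite -eab; right.
by case=> [/ne1 //|/mulgI]; exact: racg_gen_inj.
Qed.

Lemma link_chartP (v : W) (e : set W) (a : V) :
  link_chart v e = Some a <-> e = davis_edge v a.
Proof.
rewrite /link_chart; split.
  by case: pickP => // b /asboolP -> [<-].
move=> ->; case: pickP => [b /asboolP /davis_edge_inj -> //|].
by move/(_ a)/asboolP.
Qed.

Lemma local_actionP (g : W -> W) (v : W) (a : V) : davis_aut g ->
  g @` davis_edge v a = davis_edge (g v) (local_action g v a).
Proof.
case=> gbij gedge _.
have ginj : injective g by exact: bij_inj.
have ex c : exists b, g @` davis_edge v c = davis_edge (g v) b.
  have [w [b gvb]] : is_edge (g @` davis_edge v c).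
    by apply: (gedge _).1; exists v, c.
  have : davis_edge w b (g v) by rewrite -gvb; exists v => //; left.
  case=> [gvw|gvw]; exists b; rewrite gvb gvw //.
  by rewrite /davis_edge -mulgA racg_gen_sq mulg1 setUC.
have [s0 s0P] := choice ex.
have s0inj : injective s0.
  move=> c c' s0c; apply: (@davis_edge_inj v).
  apply/funext=> x; rewrite -[LHS](image_inj ginj) -[RHS](image_inj ginj).
  by rewrite !s0P s0c.
rewrite /local_action; case: pickP => [s /forallP /(_ a) /eqP /link_chartP //|].
move/(_ (perm s0inj)) => /negP[]; apply/forallP => c; apply/eqP/link_chartP.
by rewrite permE.
Qed.

Definition common_cube (x y : W) : Prop := exists C, [/\ is_cube C, C x & C y].

(* The distance being the least length of a chain of vertices with consecutive *)
(* ones in a common cube, the ball consists of the ends of chains of length at *)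
(* most n.                                                                     *)
Definition linf_ball (n : nat) (v : W) : set W :=
  [set w | exists p : seq W,
     [/\ (size p <= n)%N, path (fun x y => `[< common_cube x y >]) v p
       & last v p = w]].

End DavisComplex.

Section PermutationGroups.
Variable X : choiceType.
Implicit Types (G H U : set (X -> X)) (A : set X).

Definition is_subgroup G : Prop :=
  [/\ G id,
      forall g h, G g -> G h -> G (g \o h)
    & forall g, G g -> exists2 h, G h & cancel g h /\ cancel h g].

Definition is_transitive G : Prop := forall x y, exists2 g, G g & g x = y.

Definition stabilizer H (v : X) : set (X -> X) := [set g | H g /\ g v = v].

(* H|_A, its elements being regarded as maps A -> X. *)
Definition restriction H A : set (A -> X) := @sigL X X A @` H.

(* The topology of pointwise convergence, X being discrete. *)
Definition is_dense_in G U : Prop :=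
  U `<=` closure (G : set {ptws X -> discrete_topology X}).

Definition is_discrete G : Prop :=
  G `<=` isolated (G : set {ptws X -> discrete_topology X}).

End PermutationGroups.
Arguments restriction {X} H A.

(* Main.v *)
(* The local actions of an element of U at the two ends of an edge labelled a *)
(* differ by an even permutation of the points of a, the same one for all     *)
(* edges dual to a common hyperplane, and these permutations can be chosen    *)
(* independently for distinct hyperplanes. Call a connected finite set of     *)
(* vertices good if G realizes all of these choices on it. Since alternating  *)
(* groups are perfect, a commutator argument shows that a connected set with  *)
(* three removable vertices is good as soon as the sets obtained by removing  *)
(* any one of them are. This leaves paths; for these, the hyperplane crossed  *)
(* before the last one provides an element of G that fixes the path but moves *)
(* its last vertex, which reduces the claim to a tripod. So G is dense once   *)
(* the stars of vertices are good, which is (3) => (1).                       *)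
(* For (2) => (3), let K be the subgroup of G fixing the ball of radius 1.    *)
(* Its projections to the groups Alt(a) are normal, hence trivial or onto by  *)
(* simplicity, and they are not trivial because G is not discrete. They are   *)
(* jointly onto unless the projections to some Alt(a) and Alt(b) have the     *)
(* same kernel; this is an invariant equivalence relation on the labels, and  *)
(* it is excluded for suitable a and b by an even permutation that is trivial *)
(* on a and odd on b, and then for all a and b by transitivity.               *)
From HB Require Import structures.
Require Import Defs.
From mathcomp Require Import all_boot all_fingroup all_solvable.
From mathcomp Require Import generic_quotient.
From mathcomp Require Import all_classical.
From mathcomp Require Import topology.
From mathcomp Require Import ssralg ssrnum ssrint.
From mathcomp Require Import zify.

Set Implicit Arguments.
Unset Strict Implicit.
Unset Printing Implicit Defensive.

Local Open Scope group_scope.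
Local Open Scope classical_set_scope.

(** * Cellular automorphisms and their local actions *)

(** Everything is phrased through changes of local action. By [U_step] the change across an edge
    labelled [a] lies in [fixst a]; by [parallel_local] its triviality depends only on the
    hyperplane; and [flip], built with [compatible_aut], realizes any single change without
    disturbing the near side of the hyperplane. For the Odd graph [fixst a] is the alternating group
    on the points of [a] ([odd_fixstP]), which is simple and perfect because [a] has at least five
    points.

    (3) => (1): radius 2 controls local actions on stars ([vstar_good_of_ball2]). [three_leaves] and
    [straight_good] enlarge the sets on which [G] approximates [U], and [pods_are_good] combines
    them by induction on total length, up to [finite_good].

    (2) => (3): [local_onto_of_ball1] gives all local actions at each vertex. Among the elements of
    [G] trivial at [v], each projection to [fixst a] is onto ([stab_onto]) and distinct labels have
    incomparable kernels ([stab_le_eq]), so [commutator_fill] makes the projections jointly onto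
    ([vstar_good_of_nondiscrete]).

    (1) => (2): density copies finitely many values, and [far_flip] gives nontrivial elements of [U]
    fixing any given finite set. *)

Section DavisAutomorphisms.
Variables (V : finType) (E : rel V).
Hypotheses (Esym : symmetric E) (Eirr : irreflexive E).
Local Notation W := (racg E).
Local Notation gen := (@racg_gen V E).
Local Notation word := (@racg_word V E).
Local Notation D := (@local_action V E).

(** * Words, walks and construction of automorphisms *)

Lemma racg_word_nil : word [::] = 1.
Proof. by []. Qed.

Lemma racg_word_cons a u : word (a :: u) = gen a * word u.
Proof. by rewrite -cat1s racg_wordM. Qed.

Lemma racg_word_rcons u a : word (rcons u a) = word u * gen a.
Proof. by rewrite -cats1 racg_wordM. Qed.

Lemma racg_genK a : cancel (fun p : W => p * gen a) (fun p => p * gen a).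
Proof. by move=> p; rewrite -mulgA racg_gen_sq mulg1. Qed.

Lemma racg_genC a b : E a b -> gen a * gen b = gen b * gen a.
Proof. by move=> ab; apply/commgP/eqP; exact: (racg_relations E).2. Qed.

Lemma racg_word_ex (p : W) : exists u, p = word u.
Proof. by elim/racg_word_ind: p => u; exists u. Qed.

Lemma racg_rind (P : W -> Prop) :
  P 1 -> (forall p a, P p -> P (p * gen a)) -> forall p, P p.
Proof.
move=> P1 PM; elim/racg_word_ind; elim/last_ind => [//|u a IHu].
by rewrite racg_word_rcons; exact: PM.
Qed.

(** Words act on the states from the right and both relators act trivially, so the action factors
    through the Coxeter group. This is how functions on the group are defined here. *)
Lemma racg_walk (S : Type) (t : S -> V -> S) (s0 : S) :
    (forall s a, t (t s a) a = s) ->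
    (forall s a b, E a b -> t (t (t (t s a) b) a) b = s) ->
  exists F : W -> S, F 1 = s0 /\ forall p a, F (p * gen a) = t (F p) a.
Proof.
move=> tK tC.
have tE u v : racg_eqv E u v -> forall s, foldl t s u = foldl t s v.
  elim=> {u v} [//|//|u v w _ uv _ vw s|u u' v v' _ hu _ hv s|a s|a b ab s].
  - by rewrite uv.
  - by rewrite !foldl_cat hu hv.
  - exact: (tK s a).
  - exact: (tC s a b ab).
exists (fun p => foldl t s0 (repr p)); split.
  exact: (tE _ _ (racg_reprK E [::])).
elim/racg_word_ind=> u a; rewrite -racg_word_rcons.
by rewrite !(tE _ _ (racg_reprK E _)) -cats1 foldl_cat.
Qed.

(* Opposite edges of a square have the same label, so the local actions at    *)
(* the ends of an edge labelled [a] agree on the closed star of [a];          *)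
(* [compatible_aut] shows that this is the only constraint.                   *)
Definition compatible (f : W -> {perm V}) :=
  (forall p a b, E (f p a) (f p b) = E a b) /\
  (forall p a b, (b == a) || E a b -> f (p * gen a) b = f p b).

Definition obeys (g : W -> W) (f : W -> {perm V}) :=
  forall p a, g (p * gen a) = g p * gen (f p a).

Lemma obeys_edge g f p a :
  obeys g f -> g @` davis_edge p a = davis_edge (g p) (f p a).
Proof. by move=> gf; rewrite /davis_edge image_setU !image_set1 gf. Qed.

Lemma obeys_square g f p a b : compatible f -> obeys g f -> E a b ->
  g @` davis_square p a b = davis_square (g p) (f p a) (f p b).
Proof.
move=> [_ fst] gf ab; rewrite /davis_square !image_setU !image_set1 !gf.
by rewrite fst // ab orbT.
Qed.

Lemma obeys_inv g h f : compatible f -> obeys g f -> cancel g h -> cancel h g ->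
  let f' := fun q => (f (h q))^-1 in compatible f' /\ obeys h f'.
Proof.
move=> [fE fst] gf gK hK f'.
have hf' : obeys h f'.
  by move=> q b; apply: (can_inj gK); rewrite hK gf permKV hK.
split=> //; split=> [q a b|q a b ab].
  by rewrite -(fE (h q)) !permKV.
rewrite /f' hf'; apply: (@perm_inj _ (f (h q * gen (f' q a)))).
rewrite permKV fst ?permKV //.
by rewrite (inj_eq perm_inj) -(fE (h q)) !permKV.
Qed.

Lemma obeys_aut g h f : compatible f -> obeys g f -> cancel g h -> cancel h g ->
  davis_aut g /\ forall p, D g p = f p.
Proof.
move=> fc gf gK hK; have [f'c hf'] := obeys_inv fc gf gK hK.
have imK C : h @` (g @` C) = C.
  by rewrite image_comp (_ : h \o g = id) ?image_id //; apply/funext => x /=.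
have gaut : davis_aut g.
  split=> [|C|C]; first by exists h.
  - split=> [[p [a ->]]|[p [a gC]]].
      by exists (g p), (f p a); exact: obeys_edge.
    by rewrite -(imK C) gC (obeys_edge _ _ hf'); eexists; eexists.
  - split=> [[p [a [b [ab ->]]]]|[p [a [b [ab gC]]]]].
      exists (g p), (f p a), (f p b); rewrite fc.1; split=> //.
      exact: obeys_square.
    rewrite -(imK C) gC (obeys_square _ f'c hf' ab).
    by do 3!eexists; split; last by []; rewrite f'c.1.
split=> // p; apply/permP => a; apply: (@davis_edge_inj _ E (g p)).
by rewrite -local_actionP // (obeys_edge _ _ gf).
Qed.

(** The image is traced along walks, edge by edge; compatibility makes the images of squares close
    up. A second walk, reading labels back through [f], gives the inverse. *)
Lemma compatible_aut f w : compatible f ->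
  exists g, [/\ davis_aut g, g w = w & forall p, D g p = f p].
Proof.
move=> fc; have [fE fst] := fc.
have fcomm p a b : E a b -> f (p * gen a) b = f p b.
  by move=> ab; apply: fst; rewrite ab orbT.
have fcomm' p a b : E a b -> f (p * gen b) a = f p a.
  by move=> ab; apply: fcomm; rewrite Esym.
have fself p a : f (p * gen a) a = f p a by apply: fst; rewrite eqxx.
pose t (s : W * W) a := (s.1 * gen a, s.2 * gen (f s.1 a)).
have walk4 (q : W) a b : E a b ->
    q * gen a * gen b * gen a * gen b = q.
  by move=> ab; rewrite -(mulgA q) (racg_genC ab) mulgA racg_genK racg_genK.
have [F [F1 FM]] : exists F : W -> W * W, F 1 = (1, 1) /\
    forall p a, F (p * gen a) = t (F p) a.
  apply: racg_walk => [[p q] a|[p q] a b ab]; rewrite /t /=.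
    by rewrite fself !racg_genK.
  have e2 : f (p * gen a * gen b) a = f p a by rewrite fcomm' // fself.
  have e3 : f (p * gen a * gen b * gen a) b = f p b by rewrite fcomm // fself
    fcomm.
  by rewrite e2 e3 (fcomm _ _ _ ab) !walk4 ?fE.
have F_1 p : (F p).1 = p.
  by elim/racg_rind: p => [|p a IHp]; rewrite ?F1 ?FM //= IHp.
have gf : obeys (fun p => (F p).2) f by move=> p a; rewrite FM /= F_1.
have fV p a b : (f (p * gen ((f p)^-1 a)))^-1 b = (f p)^-1 b
    \/ ~~ ((b == a) || E a b).
  case: (boolP (_ || _)) => [ab|]; [left|by right].
  apply: (@perm_inj _ (f (p * gen ((f p)^-1 a))));
    rewrite permKV fst ?permKV //.
  by rewrite (inj_eq perm_inj) -(fE p) !permKV.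
have fVcomm p a b : E a b -> (f (p * gen ((f p)^-1 a)))^-1 b = (f p)^-1 b.
  by move=> ab; case: (fV p a b); rewrite ?ab ?orbT.
have fVcomm' p a b : E a b -> (f (p * gen ((f p)^-1 b)))^-1 a = (f p)^-1 a.
  by move=> ab; apply: fVcomm; rewrite Esym.
have fVself p a : (f (p * gen ((f p)^-1 a)))^-1 a = (f p)^-1 a.
  by case: (fV p a a); rewrite ?eqxx.
have [h [h1 hM]] : exists h : W -> W, h 1 = 1 /\
    forall q b, h (q * gen b) = h q * gen ((f (h q))^-1 b).
  apply: (@racg_walk W (fun q b => q * gen ((f q)^-1 b))) => [p b|p a b ab] /=;
    first by rewrite fVself racg_genK.
  have abV : E ((f p)^-1 a) ((f p)^-1 b) by rewrite -(fE p) !permKV.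
  set a' := (f p)^-1 a; set b' := (f p)^-1 b.
  have e1 : (f (p * gen a'))^-1 b = b' by exact: fVcomm.
  have e2 : (f (p * gen a' * gen b'))^-1 a = a'.
    by rewrite -[in gen b']e1 (fVcomm' (p * gen a') _ _ ab) fVself.
  have e3 : (f (p * gen a' * gen b' * gen a'))^-1 b = b'.
    rewrite -[X in _ * _ * gen X]e2 (fVcomm _ _ _ ab).
    by rewrite -[X in _ * _ * gen X]e1 fVself.
  by rewrite e1 e2 e3 walk4.
have gK : cancel (fun p => (F p).2) h.
  move=> p; elim/racg_rind: p => [|p a IHp]; first by rewrite F1.
  by rewrite gf hM IHp permK.
have hK : cancel h (fun p => (F p).2).
  move=> p; elim/racg_rind: p => [|p a IHp]; first by rewrite h1 F1.
  by rewrite hM gf IHp permKV.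
(* Left multiplication preserves labels, so it brings the image of [w] back to [w] without changing
   local actions. *)
pose c := w * ((F w).2)^-1.
pose g p := c * (F p).2; pose g' q := h (c^-1 * q).
have gf' : obeys g f by move=> p a; rewrite /g gf mulgA.
have g'K : cancel g g' by move=> p; rewrite /g /g' mulKg gK.
have gg'K : cancel g' g by move=> p; rewrite /g /g' hK mulVKg.
have [gaut gD] := obeys_aut fc gf' g'K gg'K.
by exists g; split=> //; rewrite /g /c mulgVK.
Qed.

(** * Local actions of arbitrary automorphisms *)

Lemma racg_parity :
  exists par : W -> bool, forall p a, par (p * gen a) = ~~ par p.
Proof.
have [|s a b _|par [_ parM]] := @racg_walk bool (fun s _ => ~~ s) true.
- by move=> s _; rewrite negbK.
- by rewrite !negbK.
- by exists par.
Qed.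

Lemma racg_gen_neq p a : p * gen a <> p.
Proof.
have [par parM] := racg_parity => /(congr1 par); rewrite parM.
by case: (par p).
Qed.

Lemma racg_gen_eq p a b : p * gen a = p * gen b -> a = b.
Proof. by move=> /mulgI /racg_gen_inj. Qed.

Lemma aut_inj g : davis_aut g -> injective (g : W -> W).
Proof. by case=> gbij _ _; exact: bij_inj. Qed.

Lemma aut_obeys g : davis_aut g -> obeys g (D g).
Proof.
move=> gaut p a; have gE := local_actionP p a gaut.
have : davis_edge (g p) (D g p a) (g (p * gen a)).
  by rewrite -gE; exists (p * gen a) => //; right.
by case=> // /(aut_inj gaut) /racg_gen_neq.
Qed.

Lemma obeys_local g f p : davis_aut g -> obeys g f -> D g p = f p.
Proof.
move=> gaut gf; apply/permP => a; apply: (@racg_gen_eq (g p)).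
by rewrite -(aut_obeys gaut).
Qed.

Lemma aut_id : davis_aut (@id W).
Proof. by split=> [|C|C]; rewrite ?image_id //; exists id. Qed.

Lemma local_id p : D id p = 1.
Proof.
rewrite (@obeys_local id (fun=> 1) p) //; first exact: aut_id.
by move=> q a; rewrite perm1.
Qed.

Lemma aut_comp g h : davis_aut g -> davis_aut h -> davis_aut ((g : W ->
  W) \o h).
Proof.
move=> [gb ge gs] [hb he hs]; split=> [|C|C]; first exact: bij_comp.
  by rewrite -image_comp -ge -he.
by rewrite -image_comp -gs -hs.
Qed.

Lemma local_comp g h p : davis_aut g -> davis_aut h ->
  D (g \o h) p = D h p * D g (h p).
Proof.
move=> ga ha; rewrite (@obeys_local _ (fun p => D h p * D g (h p)) p) //.
  exact: aut_comp.
by move=> q a /=; rewrite (aut_obeys ha) (aut_obeys ga) permM.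
Qed.

Lemma local_comp_inv g h p : davis_aut g -> davis_aut h -> cancel g h ->
  D h (g p) = (D g p)^-1.
Proof.
move=> ga ha gK; apply: (@mulgI _ (D g p)); rewrite -local_comp // mulgV.
by rewrite (_ : h \o g = id) ?local_id //; apply/funext => x /=.
Qed.

Lemma aut_inv g h : davis_aut g -> cancel g h -> cancel h g ->
  davis_aut (h : W -> W).
Proof.
move=> [gb ge gs] gK hK; have imK C : g @` (h @` C) = C.
  by rewrite image_comp (_ : g \o h = id) ?image_id //; apply/funext => x /=.
split=> [|C|C]; first by exists g.
  by rewrite (ge (h @` C)) imK.
by rewrite (gs (h @` C)) imK.
Qed.

Lemma davis_square_base p q x y : E x y ->
  davis_square p x y (q : W) -> davis_square p x y `<=` davis_square q x y.
Proof.
move=> xy; have yx : gen y * gen x = gen x * gen y by rewrite (racg_genC xy).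
have pyx r : r * gen y * gen x = r * gen x * gen y by rewrite -!mulgA yx.
case=> [[[/= ->|/= ->]|/= ->]|/= ->] r [[[/= ->|/= ->]|/= ->]|/= ->];
  rewrite /davis_square /= ?pyx ?racg_genK ?pyx ?racg_genK; tauto.
Qed.

(** The image of a square is a square, which can be based at [g p]. Parity forces the neighbours of
    [p] in it to go to neighbours of [g p] in the image, and opposite edges of the image carry equal
    labels. *)
Lemma aut_square g p a b : davis_aut g -> E a b ->
  E (D g p a) (D g p b) /\ D g (p * gen a) b = D g p b.
Proof.
move=> ga ab; have [_ _ gs] := ga.
have [par parM] := racg_parity.
have sq r : davis_square p a b r -> (g @` davis_square p a b) (g r) by exists r.
have /gs [q [x [y [xy gsq]]]] : is_square (davis_square p a b).
  by exists p, a, b.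
have bq : davis_square q x y (g p) by rewrite -gsq; apply: sq; do 3!left.
have sub r : davis_square p a b r -> davis_square (g p) x y (g r).
  by move/sq; rewrite gsq; apply: davis_square_base.
have anb : D g p a <> D g p b.
  by move/perm_inj => aab; move: ab; rewrite aab Eirr.
have lab c : davis_square p a b (p * gen c) -> D g p c = x \/ D g p c = y.
  move/sub; rewrite (aut_obeys ga) => -[[[/racg_gen_neq//|]|]|].
  - by move/racg_gen_eq; left.
  - by move/racg_gen_eq; right.
  - by move/(congr1 par); rewrite !parM; case: (par _).
have la := lab a ltac:(by left; left; right).
have lb := lab b ltac:(by left; right).
have gab : g (p * gen a * gen b) = g p * gen x * gen y.
  have /sub : davis_square p a b (p * gen a * gen b) by right.
  case=> [[[/(aut_inj ga) |]|]|//].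
  - move/(congr1 (fun r => r * gen b)); rewrite racg_genK => /racg_gen_eq aab.
    by move: ab; rewrite aab Eirr.
  - by move/(congr1 par); rewrite (aut_obeys ga) !parM (aut_obeys ga) !parM;
      case: (par _).
  - by move/(congr1 par); rewrite (aut_obeys ga) !parM (aut_obeys ga) !parM;
      case: (par _).
move: gab; rewrite !(aut_obeys ga).
case: la lb anb => -> [] -> // _ gab; split=> //.
- exact: racg_gen_eq gab.
- by rewrite Esym.
- by apply: (@racg_gen_eq (g p * gen y)); rewrite gab -!mulgA (racg_genC xy).
Qed.

Lemma aut_self g p a : davis_aut g -> D g (p * gen a) a = D g p a.
Proof.
move=> ga; apply: (@racg_gen_eq (g (p * gen a))).
by rewrite -(aut_obeys ga) racg_genK (aut_obeys ga) racg_genK.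
Qed.

End DavisAutomorphisms.

(** * Finite agreement and pointwise convergence *)

Section PointwiseTopology.
Variable X : choiceType.
Local Notation XX := {ptws X -> discrete_topology X}.

Lemma nbhs_agree (f : X -> X) (S : seq X) :
  nbhs (f : XX) [set g : XX | {in S, forall x, g x = f x}].
Proof.
elim: S => [|x S IHS].
  by apply: (@filterS _ (nbhs (f : XX)) _ setT) => //; exact: filterT.
have nx : nbhs (f : XX) [set g : XX | g x = f x].
  have h := @proj_continuous X (fun=> discrete_topology X) x f.
  apply: (h [set f x : discrete_topology X]); rewrite nbhs_principalE.
  exact/principal_filterP.
apply: filterS (filterI nx IHS) => g [gx gS] y; rewrite inE => /orP[/eqP->//|].
exact: gS.
Qed.

(** The filter generated by agreement with [f] on finite sets converges to [f] in each coordinate,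
    so it contains every neighbourhood of [f]. *)
Lemma nbhs_agreeP (f : X -> X) (B : set (X -> X)) : nbhs (f : XX) B ->
  exists S : seq X, forall g : X -> X, {in S, forall x, g x = f x} -> B g.
Proof.
pose Fl : set_system XX :=
  [set A | exists S : seq X, [set g : XX | {in S, forall x, g x = f x}] `<=` A].
have FlF : Filter Fl.
  split=> [|A A' [S SA] [S' SA']|A A' AA' [S SA]].
  - by exists [::].
  - exists (S ++ S') => g gS; split; [apply: SA|apply: SA'] => x xS;
      by apply: gS; rewrite mem_cat xS ?orbT.
  - by exists S; exact: subset_trans SA AA'.
suff : Fl --> (f : XX) by move=> h /h.
apply/cvg_sup => x A; rewrite nbhsE => -[O [[C _ <-] Cfx] OA].
exists [:: x] => g gx; apply: OA => /=.
by rewrite gx ?mem_head.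
Qed.

Lemma dense_inP (G U : set (X -> X)) : is_dense_in G U <->
  forall u (S : seq X), U u -> exists2 g, G g & {in S, forall x, g x = u x}.
Proof.
split=> [GU u S /GU/(_ _ (nbhs_agree u S))[g [Gg gS]]|GU u Uu B /nbhs_agreeP[S
  SB]].
  by exists g.
by have [g Gg gu] := GU u S Uu; exists g; split=> //; exact: SB.
Qed.

Lemma discreteP (G : set (X -> X)) : is_discrete G <->
  forall g, G g -> exists S : seq X,
    forall h, G h -> {in S, forall x, h x = g x} -> h = g.
Proof.
split=> [dG g /dG[_ [B /nbhs_agreeP[S SB] BG]]|dG g Gg].
  exists S => h Gh hg; suff : [set g] h by [].
  by rewrite -BG; split=> //; exact: SB.
have [S Sg] := dG g Gg; split; first exact/mem_set.
exists [set h : X -> X | {in S, forall x, h x = g x}]; first exact: nbhs_agree.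
apply/seteqP; split=> [h [hg Gh]|h ->]; first exact: Sg.
by split.
Qed.

End PointwiseTopology.

(** * Universal groups *)

Section UniversalGroup.
Variables (V : finType) (E : rel V).
Hypotheses (Esym : symmetric E) (Eirr : irreflexive E).
Local Notation W := (racg E).
Local Notation gen := (@racg_gen V E).
Local Notation word := (@racg_word V E).
Local Notation D := (@local_action V E).

(** * Hyperplanes and their sides *)

Definition in_star a : pred V := fun b => (b == a) || E a b.

(* The edges [w, w a] and [p, p a] are dual to the same hyperplane.           *)
Definition parallel a (w p : W) := exists2 u, all (in_star a) u & p = w * word
  u.

Lemma parallel_refl a w : parallel a w w.
Proof. by exists [::]; rewrite ?racg_word_nil ?mulg1. Qed.

Lemma racg_wordV u : word (rev u) = (word u)^-1.
Proof. exact: esym (racg_invE E u). Qed.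

Lemma parallel_sym a w p : parallel a w p -> parallel a p w.
Proof. by case=> u au ->; exists (rev u); rewrite ?all_rev ?racg_wordV ?mulgK.
  Qed.

Lemma parallel_trans a p w q : parallel a w p -> parallel a p q ->
  parallel a w q.
Proof.
case=> u au -> [v av ->]; exists (u ++ v); first by rewrite all_cat au.
by rewrite racg_wordM mulgA.
Qed.

Lemma parallel_step a w b : in_star a b -> parallel a w (w * gen b).
Proof. by move=> ab; exists [:: b] => //; apply/andP. Qed.

Lemma parallel_stepE a w p b : in_star a b ->
  parallel a w (p * gen b) <-> parallel a w p.
Proof.
move=> ab; split=> h; apply: (parallel_trans h); last exact: parallel_step.
by apply: parallel_sym; exact: parallel_step.
Qed.

Lemma parallel_mul a w p q : parallel a (q * w) (q * p) <-> parallel a w p.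
Proof.
split=> -[u au pu]; exists u => //; last by rewrite pu mulgA.
by apply: (@mulgI _ q); rewrite mulgA.
Qed.

(* [sd p] is the parity of the number of times that a path from [w] to [p]    *)
(* crosses the hyperplane dual to the edge [w, w a]. Both relators cross each *)
(* hyperplane an even number of times, so no normal form for the elements of  *)
(* the Coxeter group is needed.                                               *)
Definition is_side a (w : W) (sd : W -> bool) := sd w = false /\
  forall p b, sd (p * gen b) = sd p (+) ((b == a) && `[< parallel a w p >]).

Lemma side_ex a w : exists sd, is_side a w sd.
Proof.
pose t (s : W * bool) b :=
  (s.1 * gen b, s.2 (+) ((b == a) && `[< parallel a w s.1 >])).
have par_step p b : in_star a b ->
    `[< parallel a w (p * gen b) >] = `[< parallel a w p >].
  by move=> ab; apply/asbool_equiv_eq/parallel_stepE.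
have par_com p b c : E b c ->
    (c == a) && `[< parallel a w (p * gen b) >]
      = (c == a) && `[< parallel a w p >].
  move=> bc; case: (eqVneq c a) => //= ca.
  by apply: par_step; rewrite /in_star -ca Esym bc orbT.
have par_self p c :
    (c == a) && `[< parallel a w (p * gen c) >]
      = (c == a) && `[< parallel a w p >].
  case: (eqVneq c a) => //= ca.
  by apply: par_step; rewrite /in_star ca eqxx.
have [||F [F1 FM]] := @racg_walk V E _ t (1, false).
- by case=> p s b; rewrite /t /= racg_genK par_self addbK.
- case=> p s b c bc; have cb : E c b by rewrite Esym.
  rewrite /t /=; congr (_, _).
    by rewrite -(mulgA p) (racg_genC bc) mulgA !racg_genK.
  rewrite (par_com _ _ _ bc) (par_com _ c b cb) par_self.
  rewrite (par_com _ b c bc) par_self (par_com _ _ _ bc).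
  by case: s; case: ((b == a) && _); case: ((c == a) && _).
have F_1 p : (F p).1 = p.
  by elim/racg_rind: p => [|p b IHp]; rewrite ?F1 ?FM //= IHp.
(* The walk starts at the identity; adding its bit at [w] makes [false] the side of [w]. *)
exists (fun p => (F p).2 (+) (F w).2); split=> [|p b]; first by rewrite addbb.
by rewrite FM /= F_1 -!addbA; congr (_ (+) _); rewrite addbC.
Qed.

Definition connected_in (T : set W) := forall Q : W -> Prop,
  (forall p b, T p -> T (p * gen b) -> Q p -> Q (p * gen b)) ->
  forall p q, T p -> T q -> Q p -> Q q.

Definition crosses (T : set W) a w :=
  exists p, [/\ T p, T (p * gen a) & parallel a w p].

Lemma side_connected T a w sd : is_side a w sd -> connected_in T -> T w ->
  ~ crosses T a w -> forall p, T p -> sd p = false.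
Proof.
move=> [sdw sdM] Tc Tw ncr p Tp.
apply: (Tc (fun p => sd p = false) _ w p) => // q b Tq Tqb sdq.
rewrite sdM sdq /=; case: eqVneq Tqb => //= -> Tqa; apply/asboolP => par.
by apply: ncr; exists q.
Qed.

(* Otherwise a failed unification may compare searches over all permutations. *)
Local Opaque local_action.

(** * Changes of local action in the universal group *)

Variable F : {group {perm V}}.
Hypothesis F_aut : forall s a b, s \in F -> E (s a) (s b) = E a b.

Definition star a : {set V} := [set b | in_star a b]%SET.
Definition fixst a : {set {perm V}} := 'C_F(star a | 'P).
Canonical fixst_group a := Eval hnf in [group of fixst a].

Local Notation U := (@universal_group V E F).

Lemma fixstP s a :
  reflect (s \in F /\ forall b, in_star a b -> s b = b) (s \in fixst a).
Proof.
apply: (iffP setIP) => -[sF sfix]; split=> //.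
  by move=> b ab; apply: (astabP sfix); rewrite inE.
by apply/astabP => b; rewrite inE => ab; exact: sfix.
Qed.

Lemma U_aut g : U g -> davis_aut g. Proof. by case. Qed.

Lemma U_local g p : U g -> D g p \in F. Proof. by case=> _; apply. Qed.

Lemma U_comp g h : U g -> U h -> U ((g : W -> W) \o h).
Proof.
move=> Ug Uh; split=> [|v]; first exact: aut_comp (U_aut Ug) (U_aut Uh).
by rewrite (local_comp v (U_aut Ug) (U_aut Uh)) groupM ?U_local.
Qed.

Lemma U_inv g h : U g -> cancel g h -> cancel h g -> U (h : W -> W).
Proof.
move=> Ug gK hK; have ha := aut_inv (U_aut Ug) gK hK; split=> // v.
by rewrite -[v]hK (local_comp_inv _ (U_aut Ug) ha gK) groupV U_local.
Qed.

(** For cellular automorphisms this means having the same values at [p] and at all its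
    neighbours. *)
Definition agree_at (g h : W -> W) p := g p = h p /\ D g p = D h p.
Definition agree_on (T : set W) (g h : W -> W) := forall p, T p ->
  agree_at g h p.
Definition trivial_at (g : W -> W) p := g p = p /\ D g p = 1.
Definition trivial_on (T : set W) (g : W -> W) := forall p, T p ->
  trivial_at g p.

Lemma agree_at_comp g h h' p : davis_aut g -> davis_aut h -> davis_aut h' ->
  agree_at h h' p -> agree_at (g \o h) (g \o h') p.
Proof.
move=> ga ha ha' [hh' Dhh']; split; first by rewrite /= hh'.
by rewrite (local_comp p ga ha) (local_comp p ga ha') hh' Dhh'.
Qed.

Lemma trivial_at_id p : trivial_at id p.
Proof. by split; rewrite ?local_id. Qed.

Lemma trivial_agree g p : trivial_at g p <-> agree_at g id p.
Proof. by rewrite /agree_at local_id. Qed.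

Lemma trivial_comp g h p : davis_aut g -> davis_aut h ->
  trivial_at g p -> trivial_at h p -> trivial_at (g \o h) p.
Proof.
move=> ga ha [gp Dg] [hp Dh]; split; first by rewrite /= hp.
by rewrite (local_comp p ga ha) hp Dg Dh mulg1.
Qed.

(** Reduces approximation of [u] by [g] to triviality of a quotient. *)
Lemma agree_div g g' u p : davis_aut g -> cancel g g' -> cancel g' g ->
  davis_aut u ->
  agree_at g u p <-> trivial_at (g' \o u) p.
Proof.
move=> ga gK g'K ua; have g'a := aut_inv ga gK g'K.
have gg'u : g \o (g' \o u) = u by apply/funext => x /=.
have g'g : g' \o g = id by apply/funext => x /=.
rewrite trivial_agree; split=> h.
  have := agree_at_comp g'a ga ua h; rewrite g'g /agree_at.
  by case=> /esym e1 /esym e2; split.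
have := agree_at_comp ga (aut_comp g'a ua) (@aut_id _ E).
by rewrite gg'u => /(_ p h) [/esym e1 /esym e2]; split.
Qed.

Lemma U_step g p a : U g -> D g (p * gen a) * (D g p)^-1 \in fixst a.
Proof.
move=> Ug; apply/fixstP; split=> [|b]; first by rewrite groupM ?groupV ?U_local.
rewrite permM => /orP[/eqP->|ab]; first by rewrite (aut_self _ _ (U_aut Ug))
  permK.
by rewrite (aut_square Esym Eirr p (U_aut Ug) ab).2 permK.
Qed.

Lemma trivial_step g p a : U g -> trivial_at g p ->
  g (p * gen a) = p * gen a /\ D g (p * gen a) \in fixst a.
Proof.
move=> Ug [gp Dg]; split; first by rewrite (aut_obeys (U_aut Ug)) gp Dg perm1.
by have := U_step p a Ug; rewrite Dg invg1 mulg1.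
Qed.

Lemma trivial_step_at g p a : U g -> trivial_at g p -> D g (p * gen a) = 1 ->
  trivial_at g (p * gen a).
Proof. by move=> Ug gp; split=> //; have [] := trivial_step a Ug gp. Qed.

(* The local action may be changed by an arbitrary element of [fixst a]       *)
(* across a hyperplane labelled [a], independently of all other hyperplanes.  *)
Lemma flip a w sd alpha : is_side a w sd -> alpha \in fixst a ->
  exists2 t, U t & t w = w /\ forall p, D t p = if sd p then alpha else 1.
Proof.
move=> [sdw sdM] /fixstP[aF afix]; pose f p := if sd p then alpha else 1.
have fc : compatible f.
  split=> p b c; first by rewrite /f; case: ifP => _; rewrite ?F_aut ?perm1.
  rewrite /f sdM; case: (eqVneq b a) => [->|_ _] /=; last by rewrite addbF.
  by move=> ac; case: (sd p); case: asbool; rewrite /= ?perm1 ?afix.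
have [t [ta tw Dt]] := compatible_aut Esym w fc.
by exists t; split=> // p; rewrite Dt /f; case: ifP.
Qed.

Lemma flip_far a w sd alpha t : is_side a w sd ->
  (forall p, D t p = if sd p then alpha else 1) -> D t (w * gen a) = alpha.
Proof.
move=> [sdw sdM] Dt; rewrite Dt sdM sdw eqxx /= asboolT //.
exact: parallel_refl.
Qed.

Lemma flip_near w sd alpha t T : U t -> t w = w ->
  (forall p, D t p = if sd p then alpha else 1) ->
  connected_in T -> T w -> (forall p, T p -> sd p = false) -> trivial_on T t.
Proof.
move=> Ut tw Dt Tc Tw sd0.
have Dt1 p : T p -> D t p = 1 by move=> Tp; rewrite Dt sd0.
move=> p Tp; split; last exact: Dt1.
apply: (Tc (fun p => t p = p) _ w) => // q b Tq Tqb tq.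
by rewrite (aut_obeys (U_aut Ut)) tq Dt1 // perm1.
Qed.

Hypothesis F_disj : forall a b s, E a b -> s \in fixst a -> s \in fixst b ->
  s = 1.

(** Seen from [p * gen a] the local action at the fourth corner lies in [fixst b], seen from
    [p * gen b] in [fixst a]; these meet trivially. *)
Lemma trivial_square g p a b : U g -> E a b -> trivial_at g p ->
  trivial_at g (p * gen a) -> trivial_at g (p * gen b) ->
  trivial_at g (p * gen a * gen b).
Proof.
move=> Ug ab gp ga gb.
have [gab Dab] := trivial_step b Ug ga; split=> //.
have [_] := trivial_step a Ug gb.
by rewrite -mulgA -(racg_genC ab) mulgA => Dba; exact: F_disj ab Dba Dab.
Qed.

(** Moving the edge across a square with other label [b], the new change lies in [fixst a], and also
    in [fixst b], being a product of changes across the two edges labelled [b]. Hence it is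
    trivial. *)
Lemma parallel_local g a p q : U g -> parallel a p q ->
  D g (p * gen a) = D g p -> D g (q * gen a) = D g q.
Proof.
move=> Ug [u au ->] {q}; elim/last_ind: u au => [|u b IHu].
  by rewrite racg_word_nil mulg1.
rewrite all_rcons => /andP[ab /IHu{}IHu] /IHu.
rewrite racg_word_rcons mulgA; move: (p * word u) => {IHu} r Dr.
case/orP: ab => [/eqP->|ab]; first by rewrite racg_genK.
apply: (mulIg (D g (r * gen b))^-1); rewrite mulgV.
apply: (F_disj ab); first exact: U_step.
have := groupM (U_step (r * gen a) b Ug) (groupVr (U_step r b Ug)).
by rewrite -!mulgA (racg_genC ab) invMg invgK Dr mulKg.
Qed.

(** Either the hyperplane is already crossed inside [T], so that the change across it is determined
    there, or [T] lies on one side and a flip of the other side is free. *)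
Lemma connected_dichotomy T w a : connected_in T -> T w ->
  (forall u, U u -> trivial_on T u -> trivial_at u (w * gen a)) \/
  (forall alpha, alpha \in fixst a ->
     exists2 t, U t & trivial_on T t /\ D t (w * gen a) = alpha).
Proof.
move=> Tc Tw; case: (pselect (crosses T a w)) => [[p [Tp Tpa wp]]|ncr].
  left=> u Uu uT; apply: trivial_step_at (uT w Tw) _ => //.
  rewrite (parallel_local Uu (parallel_sym wp)) ?(uT w Tw).2 //.
  by rewrite (uT p Tp).2 (uT _ Tpa).2.
right=> alpha al; have [sd sds] := side_ex a w.
have [t Ut [tw Dt]] := flip sds al; exists t => //.
have sd0 := side_connected sds Tc Tw ncr; split; last exact: flip_far Dt.
exact: flip_near Ut tw Dt Tc Tw sd0.
Qed.

(** * Approximation by [G] and commutators *)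

Hypothesis F_perfect : forall a, fixst a \subset [~: fixst a, fixst a].
Variable G : set (W -> W).
Hypotheses (G_subgroup : is_subgroup G) (GU : G `<=` U).

Lemma G_comp g h : G g -> G h -> G ((g : W -> W) \o h).
Proof. by case: G_subgroup => _ GM _; exact: GM. Qed.

Lemma G_inv g : G g -> exists h, [/\ G h, cancel g h & cancel h g].
Proof. by case: G_subgroup => _ _ GV /GV[h Gh [gK hK]]; exists h. Qed.

(* [G] approximates all elements of [U] on the 1-neighbourhood of [T].        *)
Definition good (T : set W) := forall u, U u -> exists2 g, G g & agree_on T g u.

Lemma good_ext (T T' : set W) : good T ->
  (forall u, U u -> trivial_on T u -> trivial_on T' u) -> good T'.
Proof.
move=> gT TT' u Uu; have [g Gg gu] := gT u Uu; exists g => // p T'p.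
have [h [Gh gK hK]] := G_inv Gg.
apply/(agree_div p (U_aut (GU Gg)) gK hK (U_aut Uu)).
apply: TT' => //; first by apply: U_comp => //; exact: GU.
by move=> q /gu; move/(agree_div q (U_aut (GU Gg)) gK hK (U_aut Uu)).
Qed.

Lemma good_sub (T T' : set W) : good T -> T' `<=` T -> good T'.
Proof. by move=> gT sT; apply: (good_ext gT) => u _ uT p /sT /uT. Qed.

(** Maps compose from right to left but permutations from left to right, whence the order of the
    factors of [k]. *)
Lemma local_commutator g g' h h' p : U g -> cancel g g' -> cancel g' g ->
    U h -> cancel h h' -> cancel h' h -> g p = p -> h p = p ->
  let k := (h : W -> W) \o (g \o (h' \o g')) in
  k p = p /\ D k p = [~ D g p, D h p].
Proof.
move=> Ug gK g'K Uh hK h'K gp hp k.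
have ga := U_aut Ug; have ha := U_aut Uh.
have g'a := aut_inv ga gK g'K; have h'a := aut_inv ha hK h'K.
have g'p : g' p = p by rewrite -[in LHS]gp gK.
have h'p : h' p = p by rewrite -[in LHS]hp hK.
split; first by rewrite /k /= g'p h'p gp hp.
have Dg' : D g' p = (D g p)^-1 by rewrite -(local_comp_inv p ga g'a gK) gp.
have Dh' : D h' p = (D h p)^-1 by rewrite -(local_comp_inv p ha h'a hK) hp.
have c1 := aut_comp h'a g'a; have c2 := aut_comp ga c1.
rewrite /k (local_comp p ha c2) (local_comp p ga c1) (local_comp p h'a g'a) /=.
by rewrite g'p h'p gp Dg' Dh' commgEl conjgE !mulgA.
Qed.

(* If [s] is trivial at [y] and [t] is trivial on [Y], then their commutator  *)
(* is trivial on both, and commutators generate [fixst a].                    *)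
Lemma commutator_fill (T0 : set W) w a (Y : seq W) : T0 w ->
    (forall y, y \in Y -> exists q c, T0 q /\ y = q * gen c) ->
    (forall alpha, alpha \in fixst a ->
       exists2 s, G s & trivial_on T0 s /\ D s (w * gen a) = alpha) ->
    (forall y, y \in Y -> forall alpha, alpha \in fixst a ->
       exists2 s, G s & trivial_on (y |` T0) s /\ D s (w * gen a) = alpha) ->
  forall alpha, alpha \in fixst a ->
    exists2 s, G s & trivial_on (T0 `|` [set` Y]) s /\ D s (w * gen a) = alpha.
Proof.
move=> Tw adj; elim: Y adj => [|y Y IHY] adj base step.
  move=> al /base[s Gs [sT Ds]]; exists s => //; split=> // p [/sT//|].
  by rewrite /= in_nil.
have {}IHY := IHY (fun z zY => adj z (mem_behead (s := y :: Y) zY)) base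
  (fun z zY => step z (mem_behead (s := y :: Y) zY)).
set T := T0 `|` _ => al al_a.
pose A := [set al in fixst a |
  `[< exists2 s, G s & trivial_on T s /\ D s (w * gen a) = al >]]%SET.
have AP be : be \in A -> exists2 s, G s & trivial_on T s /\ D s (w * gen a) =
  be.
  by rewrite inE => /andP[_ /asboolP].
have GA s : G s -> trivial_on T s -> D s (w * gen a) \in A.
  move=> Gs sT; rewrite inE; apply/andP; split; last by apply/asboolP; exists s.
  by have [] := trivial_step a (GU Gs) (sT w (or_introl Tw)).
have gA : group_set A.
  apply/group_setP; split=> [|be ga /AP[s Gs [sT <-]] /AP[t Gt [tT <-]]].
    rewrite -(local_id (w * gen a)); apply: GA; first by case: G_subgroup.
    by move=> p _; exact: trivial_at_id.
  have [sw _] := trivial_step a (GU Gs) (sT w (or_introl Tw)).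
  rewrite -[X in _ * D t X]sw -(local_comp _ (U_aut (GU Gt)) (U_aut (GU Gs))).
  apply: GA; first exact: G_comp.
  by move=> p Tp; apply: trivial_comp; [exact: U_aut (GU _)..|exact: tT|exact:
    sT].
apply: AP; suff sA : [~: fixst a, fixst a] \subset A.
  by apply: (fintype.subsetP sA); apply: (fintype.subsetP (F_perfect a)).
rewrite -[A]/(gval (Group gA)) gen_subG; apply/fintype.subsetP => _ /imset2P[x z
  xa za ->].
have [g Gg [gT Dg]] := step y (mem_head y Y) x xa.
have [h Gh [hT Dh]] := IHY z za.
have [g' [Gg' gK g'K]] := G_inv Gg; have [h' [Gh' hK h'K]] := G_inv Gh.
have com p := local_commutator (GU Gg) gK g'K (GU Gh) hK h'K (p := p).
have [gw _] := trivial_step a (GU Gg) (gT w (or_intror Tw)).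
have [hw _] := trivial_step a (GU Gh) (hT w (or_introl Tw)).
have [_] := com _ gw hw; rewrite Dg Dh => <-; apply: GA;
  first exact: (G_comp Gh (G_comp Gg (G_comp Gh' Gg'))).
have fixes q c s : U s -> trivial_at s q -> s (q * gen c) = q * gen c.
  by move=> Us sq; have [] := trivial_step c Us sq.
move=> p; rewrite /T /= in_cons => -[Tp|/orP[/eqP->|pY]].
- have [gp Dgp] := gT p (or_intror Tp); have [hp _] := hT p (or_introl Tp).
  by have [kp Dk] := com _ gp hp; split=> //; rewrite Dk Dgp comm1g.
- have [gy Dgy] := gT y (or_introl erefl).
  have [q [c [Tq yq]]] := adj y (mem_head y Y).
  have hy : h y = y by rewrite yq; apply: fixes (GU Gh) (hT q (or_introl Tq)).
  by have [ky Dk] := com _ gy hy; split=> //; rewrite Dk Dgy comm1g.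
- have [hp Dhp] := hT p (or_intror pY).
  have [|q [c [Tq pq]]] := adj p; first by rewrite in_cons pY orbT.
  have gp : g p = p by rewrite pq; apply: fixes (GU Gg) (gT q (or_intror Tq)).
  by have [kp Dk] := com _ gp hp; split=> //; rewrite Dk Dhp commg1.
Qed.

Lemma connected_add T w a : connected_in T -> T w ->
  connected_in (w * gen a |` T).
Proof.
move=> Tc Tw Q Qstep p q Tp Tq Qp.
have QT r s : T r -> T s -> Q r -> Q s.
  by move=> Tr Ts; apply: Tc => // r' b Tr' Trb; apply: Qstep; right.
have Qx : Q w -> Q (w * gen a) by apply: Qstep; [right|left].
have Qw : Q (w * gen a) -> Q w.
  by rewrite -{2}(racg_genK a w); apply: Qstep; rewrite ?racg_genK;
    [left|right].
have {Tp Qp} Qp : Q w by case: Tp Qp => [->//|Tp]; apply: QT.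
by case: Tq => [->|Tq]; [exact: Qx | exact: QT Qp].
Qed.

(** After correction on [x1], [x2] and [T0] only the change at [x3] is left. If it is not forced,
    the pairs [x1], [x3] and [x2], [x3] supply elements that are trivial at one of [x1], [x2] and
    arbitrary at [x3]; their commutators are trivial at both. *)
Lemma three_leaves T0 (w1 w2 w3 : W) a1 a2 a3 : connected_in T0 ->
    T0 w1 -> T0 w2 -> T0 w3 ->
  let x1 := w1 * gen a1 in let x2 := w2 * gen a2 in let x3 := w3 * gen a3 in
  good (x1 |` (x2 |` T0)) -> good (x1 |` (x3 |` T0)) ->
    good (x2 |` (x3 |` T0)) ->
  good (x1 |` (x2 |` (x3 |` T0))).
Proof.
move=> Tc Tw1 Tw2 Tw3 x1 x2 x3 g12 g13 g23 u Uu.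
set T := x1 |` (x2 |` T0) in g12.
have Tcon : connected_in T.
  by apply: connected_add; [apply: connected_add | right].
have Tw : T w3 by right; right.
have [g Gg gu] := g12 u Uu; have [h [Gh gK hK]] := G_inv Gg.
have divE q := agree_div q (U_aut (GU Gg)) gK hK (U_aut Uu).
pose u' := h \o u; have Uu' : U u' by apply: U_comp (GU Gh) Uu.
have u'T : trivial_on T u' by move=> q /gu /divE.
have TT q : (x1 |` (x2 |` (x3 |` T0))) q -> q = x3 \/ T q.
  by case=> [->|[->|[->|Tq]]];
    [right;left|right;right;left|left|right;right;right].
have [triv|onto] := connected_dichotomy a3 Tcon Tw.
  by exists g => // q /TT[->|/gu//]; apply/divE/triv.
pose al := D u' x3.
have al_a : al \in fixst a3 by have [] := trivial_step a3 Uu' (u'T _ Tw).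
have real Y : good (x3 |` Y) -> Y `<=` T -> forall al, al \in fixst a3 ->
    exists2 s, G s & trivial_on Y s /\ D s x3 = al.
  move=> gY YT be /onto[t Ut [tT Dt]]; have [s Gs st] := gY t Ut;
    exists s => //.
  split=> [q Yq|]; last by rewrite (st x3 _).2 //; left.
  have [sq Dsq] := st q (or_intror Yq); have [tq Dtq] := tT q (YT q Yq).
  by split; rewrite ?sq ?Dsq.
have [|||s Gs [sT Ds]] := @commutator_fill T0 w3 a3 [:: x1;
  x2] Tw3 _ _ _ al al_a.
- move=> y; rewrite !inE => /orP[]/eqP->; [exists w1, a1|exists w2, a2] => //.
- apply: real; first by apply: good_sub g13 _ => q [->|Tq]; right; [left|right].
  by move=> q Tq; right; right.
- move=> y; rewrite !inE => /orP[]/eqP->; apply: real.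
  + by apply: good_sub g13 _ => q [->|[->|Tq]]; [right;left|left|right;right].
  + by move=> q [->|Tq]; [left|right;right].
  + by apply: good_sub g23 _ => q [->|[->|Tq]]; [right;left|left|right;right].
  + by move=> q [->|Tq]; right; [left|right].
have sT' q : T q -> trivial_at s q.
  move=> Tq; apply: sT; case: Tq => [->|[->|Tq]]; [right|right|by left].
    by rewrite /= !inE eqxx.
  by rewrite /= !inE eqxx orbT.
exists (g \o s); first exact: G_comp.
have gsu q : agree_at s u' q -> agree_at (g \o s) u q.
  move=> su; rewrite (_ : u = g \o u'); last by apply/funext => r /=;
    rewrite hK.
  by apply: agree_at_comp su; [exact: U_aut (GU _)..|exact: U_aut].
move=> q /TT[->|Tq]; apply: gsu.
  have [sx _] := trivial_step a3 (GU Gs) (sT' _ Tw).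
  by have [ux _] := trivial_step a3 Uu' (u'T _ Tw); split=> //; rewrite sx ux.
by have [sq Dsq] := sT' q Tq; have [uq Duq] := u'T q Tq; split;
  rewrite ?sq ?uq ?Dsq ?Duq.
Qed.

Lemma side_cross a w sd p v : is_side a w sd -> sd p != sd (p * word v) ->
  exists v1 v2, v = v1 ++ a :: v2 /\ parallel a w (p * word v1).
Proof.
move=> [_ sdM]; elim/last_ind: v => [|v b IHv].
  by rewrite racg_word_nil mulg1 eqxx.
rewrite racg_word_rcons mulgA sdM.
case: (boolP (sd p == sd (p * word v))) => [/eqP<- | /IHv[v1 [v2 [-> par]]] _];
  last first.
  by exists v1, (rcons v2 b); rewrite rcons_cat.
case: (eqVneq b a) => [->|_]; last by rewrite addbF eqxx.
case: (asboolP (parallel a w (p * word v))) => [par _|_];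
  last by rewrite addbF eqxx.
by exists v, [::]; rewrite cats1.
Qed.

(* No path labelled [u] crosses a hyperplane twice.                           *)
Definition no_recross (u : seq V) := forall u1 b f u2,
  u = u1 ++ b :: f ++ b :: u2 -> ~ parallel b 1 (word f).

Lemma parallel_cross a p f : parallel a p (p * gen a * word f) <-> parallel a 1
  (word f).
Proof.
have aa : in_star a a by rewrite /in_star eqxx.
split=> [h|[v av vf]].
  have := parallel_trans (parallel_sym (parallel_step p aa)) h.
  by rewrite -{1}[p * gen a]mulg1 => /parallel_mul.
exists (a :: v); first by rewrite /= aa.
by rewrite racg_word_cons mulgA vf mul1g.
Qed.

(* Between two consecutive crossings of a hyperplane labelled [b], every      *)
(* hyperplane crossed once must by parity also be crossed by some path along  *)
(* the carrier, so its label is adjacent to [b].                              *)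
Lemma recross_factor u :
  (exists u1 b f u2, u = u1 ++ b :: f ++ b :: u2 /\ all (E b) f) \/ no_recross
    u.
Proof.
have [n] := ubnP (size u); elim: n u => // n IHn u; rewrite ltnS => un.
case: (pselect (exists u1 b f u2, u = u1 ++ b :: f ++ b :: u2 /\ all (E b) f)).
  by left.
move=> noR; right=> u1 b f u2 uE bf; apply: (noR); exists u1, b, f, u2.
split=> //; apply/allP => e ef.
(* The shorter word [b :: f] has no such factor, since it would be one of [u]; so it crosses no
   hyperplane twice. *)
have [|[v1 [c [g [v2 [bfE cg]]]]]|NR] := IHn (b :: f).
- by move: un; rewrite uE !size_cat /= size_cat /=; lia.
- exfalso; apply: noR; exists (u1 ++ v1), c, g, (v2 ++ b :: u2); split=> //.
  by rewrite uE -cat_cons bfE -!catA /= -!catA.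
have [f1 [f2 fE]] : exists f1 f2, f = f1 ++ e :: f2.
  by case/splitPr: ef => f1 f2; exists f1, f2.
have [sd sds] := side_ex e (word f1); have [sd1 sdM] := sds.
have sd0 : sd 1 = false.
  case sd0: (sd 1) => //; exfalso.
  have [|h [h' [f1E]]] := side_cross (p := 1) (v := f1) sds.
    by rewrite mul1g sd0 sd1.
  rewrite mul1g f1E racg_wordM racg_word_cons mulgA =>
    /parallel_sym/parallel_cross.
  by apply: (NR (b :: h) e h' f2); rewrite fE f1E -catA.
have sdf : sd (word f) = true.
  case sdf: (sd (word f)) => //; exfalso.
  have [|h [h' [f2E]]] := side_cross (p := word f1 * gen e) (v := f2) sds.
    rewrite sdM eqxx sd1 asboolT /=; last exact: parallel_refl.
    by rewrite -mulgA -racg_word_cons -racg_wordM -fE sdf.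
  by move/parallel_cross; apply: (NR (b :: f1) e h h'); rewrite fE f2E.
(* The path [v] along the carrier joins points on different sides of the hyperplane of [e], so it
   contains the letter [e], which is [b] or adjacent to it. Equality would be a second crossing
   within [b :: f]. *)
have [v bv] := bf; rewrite mul1g => fv.
have [|v1 [v2 [vE]]] := side_cross (p := 1) (v := v) sds.
  by rewrite mul1g -fv sd0 sdf.
rewrite mul1g => par; move: bv; rewrite vE all_cat /= => /and3P[bv1 /orP[/eqP
  eb|//] _].
exfalso; apply: (NR [::] b f1 f2); first by rewrite fE eb.
apply: parallel_sym; rewrite eb in par; apply: (parallel_trans par).
by apply: parallel_sym; exists v1; rewrite ?mul1g.
Qed.

(* The union of the paths from [v] labelled by the words of [ws].             *)
Definition pod v (ws : seq (seq V)) : set W :=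
  [set p | p = v \/ exists u1 u2, (u1 ++ u2) \in ws /\ p = v * word u1].

Definition along (P : W -> Prop) v u := forall u1 u2, u = u1 ++ u2 ->
  P (v * word u1).

Lemma along_nil (P : W -> Prop) v : P v -> along P v [::].
Proof. by move=> Pv [|//] u2 _; rewrite racg_word_nil mulg1. Qed.

Lemma along_cons (P : W -> Prop) v a u :
  along P v (a :: u) <-> P v /\ along P (v * gen a) u.
Proof.
split=> [h|[Pv h] [|b u1] u2].
- split; first by have := h [::] _ erefl; rewrite racg_word_nil mulg1.
  move=> u1 u2 uE; rewrite -mulgA -racg_word_cons.
  by apply: (h _ u2); rewrite uE.
- by rewrite racg_word_nil mulg1.
- by case=> <- uE; rewrite racg_word_cons mulgA; exact: h uE.
Qed.

Lemma along_end P v u : along P v u -> P (v * word u).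
Proof. by move=> h; apply: (h u [::]); rewrite cats0. Qed.

Lemma along_start P v u : along P v u -> P v.
Proof. by move=> h; have := h [::] u erefl; rewrite racg_word_nil mulg1. Qed.

Lemma along_cat P v u1 u2 :
  along P v (u1 ++ u2) <-> along P v u1 /\ along P (v * word u1) u2.
Proof.
elim: u1 v => [|a u1 IH] v /=.
  rewrite racg_word_nil mulg1; split=> [h|[]//]; split=> //.
  exact: along_nil (along_start h).
by rewrite !along_cons IH racg_word_cons mulgA; tauto.
Qed.

Lemma along_rev P v u : along P v u <-> along P (v * word u) (rev u).
Proof.
have fwd v' u' : along P v' u' -> along P (v' * word u') (rev u').
  elim/last_ind: u' => [|u' a IHu] h; first by apply: along_nil (along_end h).
  rewrite rev_rcons along_cons; split; first exact: along_end h.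
  rewrite racg_word_rcons mulgA racg_genK; apply: IHu.
  by move: h; rewrite -cats1 along_cat => -[].
split; first exact: fwd.
by move/fwd; rewrite revK racg_wordV mulgK.
Qed.

Lemma pod_along (P : W -> Prop) v ws : ws != [::] ->
  (forall p, pod v ws p -> P p) <-> (forall u, u \in ws -> along P v u).
Proof.
move=> ws0; split=> [h u uws u1 u2 uE|h p [->|[u1 [u2 [/h hu ->]]]]].
- by apply: h; right; exists u1, u2; rewrite -uE.
- case: ws ws0 h => // u ws _ h.
  exact: along_start (h u (mem_head u ws)).
- exact: hu.
Qed.

Lemma pod_connected v ws : connected_in (pod v ws).
Proof.
move=> Q step; have root : pod v ws v by left.
have iff p : pod v ws p -> (Q v <-> Q p).
  case=> [->//|[u1 [u2 [uws ->]]]].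
  elim/last_ind: u1 u2 uws => [|u1 a IHu] u2; first by rewrite racg_word_nil
    mulg1.
  rewrite cat_rcons => uws; rewrite (IHu _ uws) racg_word_rcons mulgA.
  have P1 : pod v ws (v * word u1) by right; exists u1, (a :: u2).
  have P2 : pod v ws (v * word u1 * gen a).
    by right; exists (rcons u1 a), u2; rewrite cat_rcons racg_word_rcons mulgA.
  split=> [|Q2]; first exact: step.
  by rewrite -(racg_genK a (v * word u1)); apply: step; rewrite ?racg_genK.
by move=> p q /iff Pp /iff Pq; rewrite -Pp Pq.
Qed.

Lemma pod_perm v ws ws' : ws =i ws' -> pod v ws = pod v ws'.
Proof.
move=> e; apply/seteqP; split=> p [->|[u1 [u2 [uws ->]]]]; try by left.
  by right; exists u1, u2; rewrite -e.
by right; exists u1, u2; rewrite e.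
Qed.

Lemma pod_rcons v u a ws :
  pod v (rcons u a :: ws) = v * word u * gen a |` pod v (u :: ws).
Proof.
apply/seteqP; split=> [p [->|[u1 [u2 []]]]|p [->|[->|[u1 [u2 []]]]]].
- by right; left.
- rewrite in_cons => /orP[/eqP|uws ->]; last first.
    by right; right; exists u1, u2; rewrite in_cons uws orbT.
  case/lastP: u2 => [|u2 b].
    by rewrite cats0 => -> ->; left; rewrite racg_word_rcons mulgA.
  rewrite -rcons_cat => /rcons_inj[<- _] ->; right; right.
  by exists u1, u2; rewrite mem_head.
- right; exists (rcons u a), [::].
  by rewrite cats0 mem_head racg_word_rcons mulgA.
- by left.
- rewrite in_cons => /orP[/eqP uE ->|uws ->]; right; last first.
    by exists u1, u2; rewrite in_cons uws orbT.
  by exists u1, (rcons u2 a); rewrite -rcons_cat uE mem_head.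
Qed.

Definition pods_good m := forall v ws, size (flatten ws) <= m ->
  good (pod v ws).

Lemma pod_rcons2 v u u' a a' ws : pod v (rcons u a :: rcons u' a' :: ws) =
  v * word u * gen a |` (v * word u' * gen a' |` pod v (u :: u' :: ws)).
Proof.
have perm12 (x y : seq V) zs : [:: x, y & zs] =i [:: y, x & zs].
  by move=> z; rewrite !inE orbCA.
by rewrite pod_rcons (pod_perm _ (perm12 _ _ _)) pod_rcons (pod_perm _ (perm12 _
  _ _)).
Qed.

Lemma pod_three m v u1 u2 u3 a1 a2 a3 ws : pods_good m ->
    let ws' := [:: rcons u1 a1, rcons u2 a2, rcons u3 a3 & ws] in
  size (flatten ws') <= m.+1 -> good (pod v ws').
Proof.
move=> gm ws' sz; set T0 := pod v [:: u1, u2, u3 & ws].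
have szE := sz; move: szE; rewrite /= !size_cat !size_rcons => szE.
have podE : pod v ws' = v * word u1 * gen a1 |` (v * word u2 * gen a2 |`
    (v * word u3 * gen a3 |` T0)).
  rewrite /ws' pod_rcons2 (@pod_perm v _ [:: rcons u3 a3, u1, u2 & ws]);
    last first.
    by move=> z; rewrite !inE; do 3!case: (z == _) => //=.
  rewrite pod_rcons (@pod_perm v _ [:: u1, u2, u3 & ws]) // => z.
  by rewrite !inE; do 3!case: (z == _) => //=.
rewrite podE; apply: three_leaves.
- exact: pod_connected.
- by right; exists u1, [::]; rewrite cats0 !inE eqxx.
- by right; exists u2, [::]; rewrite cats0 !inE eqxx ?orbT.
- by right; exists u3, [::]; rewrite cats0 !inE eqxx ?orbT.
- have /(gm v) : (size (flatten [:: rcons u1 a1, rcons u2 a2, u3 & ws]) <= m)%N.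
    by rewrite /= !size_cat !size_rcons; lia.
  by rewrite pod_rcons2.
- have /(gm v) : (size (flatten [:: rcons u1 a1, rcons u3 a3, u2 & ws]) <= m)%N.
    by rewrite /= !size_cat !size_rcons; lia.
  rewrite pod_rcons2 (@pod_perm v _ [:: u1, u2, u3 & ws]) // => z.
  by rewrite !inE; do 3!case: (z == _) => //=.
- have /(gm v) : (size (flatten [:: rcons u2 a2, rcons u3 a3, u1 & ws]) <= m)%N.
    by rewrite /= !size_cat !size_rcons; lia.
  rewrite pod_rcons2 (@pod_perm v _ [:: u1, u2, u3 & ws]) // => z.
  by rewrite !inE; do 3!case: (z == _) => //=.
Qed.

(** The end of [x] is on the [false] side. Were an earlier vertex on the other side, [x] would cross
    the hyperplane that the last letter [a] crosses again. *)
Lemma no_recross_side x a v sd : no_recross (rcons x a) ->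
  is_side a (v * word x) sd -> forall p, pod v [:: x] p -> sd p = false.
Proof.
move=> NR sds; have sdx : sd (v * word x) = false by case: sds.
have h x1 x2 : x = x1 ++ x2 -> sd (v * word x1) = false.
  move=> xE; case sd1: (sd (v * word x1)) => //; exfalso.
  have [|y1 [y2 [x2E]]] := side_cross (p := v * word x1) (v := x2) sds.
    by rewrite sd1 -mulgA -racg_wordM -xE sdx.
  rewrite xE x2E !racg_wordM racg_word_cons !mulgA =>
    /parallel_sym/parallel_cross.
  by apply: (NR (x1 ++ y1) a y2 [::]); rewrite xE x2E -cats1 -!catA.
move=> p [->|[x1 [x2 [xE ->]]]]; last by apply: (h _ x2); move: xE;
  rewrite inE => /eqP.
by have := h [::] x erefl; rewrite racg_word_nil mulg1.
Qed.

Lemma no_recross_cat x y : no_recross (x ++ y) -> no_recross x.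
Proof. by move=> NR u1 b f u2 xE; apply: (NR u1 b f (u2 ++ y));
  rewrite xE -!catA /= -catA. Qed.

Lemma trivial_pod g v ws : ws != [::] ->
  trivial_on (pod v ws) g <-> (forall u, u \in ws -> along (trivial_at g) v u).
Proof. exact: pod_along. Qed.

Lemma trivial_pod1 g v u : trivial_on (pod v [:: u]) g <-> along (trivial_at g)
  v u.
Proof.
rewrite trivial_pod //; split=> [|h w]; first by apply; rewrite inE.
by rewrite inE => /eqP->.
Qed.

Lemma trivial_ladder g p b f : U g -> all (E b) f -> along (trivial_at g) p f ->
  trivial_at g (p * gen b) -> along (trivial_at g) (p * gen b) f.
Proof.
move=> Ug; elim: f p => [|c f IHf] p /=; first by move=> _ _; exact: along_nil.
case/andP=> bc bf; rewrite !along_cons => -[gp gf] gb; split=> //.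
rewrite -mulgA (racg_genC bc) mulgA; apply: IHf => //.
by apply: (trivial_square Ug _ gp) => //; [rewrite Esym |
  exact: along_start gf].
Qed.

Lemma racg_commute b f : all (E b) f -> gen b * (word f * gen b) = word f.
Proof.
elim: f => [|c f IHf] /=; first by rewrite racg_word_nil mul1g racg_gen_sq.
case/andP=> bc /IHf fE; rewrite racg_word_cons -[in RHS]fE !mulgA.
by rewrite (racg_genC bc).
Qed.

(** Since [b] commutes with [f], the detour [b f b] ends where [f] does. The legs back along [u1],
    along [f ++ u2] and along [b] have one letter less in total, and a ladder of squares recovers
    the original path. *)
Lemma recross_good m v u1 b f u2 : pods_good m -> all (E b) f ->
  let u := u1 ++ b :: f ++ b :: u2 in size u <= m.+1 -> good (pod v [:: u]).
Proof.
move=> gm bf u sz; pose p := v * word u1.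
have /(gm p) gp : (size (flatten [:: rev u1; f ++ u2; [:: b]]) <= m)%N.
  by move: sz; rewrite /u /= !size_cat /= size_cat size_rev /=; lia.
apply: (good_ext gp) => g Ug /trivial_pod/= h; apply/trivial_pod1.
have h1 := h isT (rev u1) (mem_head _ _).
have [hf h2] := (along_cat _ _ _ _).1 (h isT (f ++ u2) ltac:(by rewrite !inE
  eqxx orbT)).
have hb := along_end (h isT [:: b] ltac:(by rewrite !inE eqxx !orbT)).
apply/along_cat; split; first exact/along_rev.
apply/along_cons; split; first exact: along_start h1.
apply/along_cat; split; first exact: trivial_ladder hb.
apply/along_cons; split; first exact: along_end (trivial_ladder Ug bf hf hb).
have <- : p * word f = p * gen b * word f * gen b.
  by rewrite -[in LHS](racg_commute bf) !mulgA.
by [].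
Qed.

(** * From stars to finite sets *)

Hypothesis F_move : forall b c, c != b -> ~~ E b c ->
  exists2 beta, beta \in fixst b & beta c != c.
Definition vstar (v : W) : set W := [set p | p = v \/ exists a, p = v * gen a].

Section Pods.
Hypothesis star_good : forall v, good (vstar v).

(* Let [z] be the last but one vertex of the path and [zc] the last one.      *)
(* There is [t] in [G] that is trivial on the path up to the vertex before    *)
(* [z], with [t z = z] and [t zc = y <> zc]. If [s] in [G] is trivial on the  *)
(* path from the second vertex to [z] and at [y], and has the required local  *)
(* action at [zc], then [s t^-1 s^-1 t] has the same local action at [zc] as  *)
(* [s], and the unknown local action of [s] at the first vertex [v] cancels.  *)
Lemma straight_good m v e u b c : pods_good m ->
  let x := e :: u in no_recross (rcons (rcons x b) c) -> ~~ E b c ->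
  size (rcons (rcons x b) c) <= m.+1 -> good (pod v [:: rcons (rcons x b) c]).
Proof.
move=> gm x NR nbc sz; move: (sz); rewrite !size_rcons ltnS => sz1.
have NRx : no_recross (rcons x b).
  by apply: (@no_recross_cat _ [:: c]); rewrite cats1.
have cb : c != b.
  apply/eqP => cb; apply: (NR x b [::] [::]); first by rewrite cb -!cats1 -catA.
  exact: parallel_refl.
have [beta b_be be_c] := F_move cb nbc.
pose w := v * word x; pose z := w * gen b; pose y := z * gen (beta c).
have zE : z = v * word (rcons x b) by rewrite racg_word_rcons mulgA.
have g1 : good (pod v [:: rcons x b]).
  by apply: gm; rewrite /= cats0 size_rcons.
pose v1 := v * gen e.
have zE1 : z = v1 * word (rcons u b) by rewrite zE racg_word_cons mulgA.
(* The long leg stops at [v1], one step short of [v], so the total length is still at most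
   [m.+1]. *)
have g3 : good (pod z [:: rev (rcons u b); [:: c]; [:: beta c]]).
  rewrite rev_rcons (lastI b (rev u)); apply: (@pod_three m z _ [::] [::]
    _ c (beta c) [::]) => //=.
  by rewrite size_cat size_rcons size_belast size_rev /=; move: sz1 => /=; lia.
have [sd1 sds1] := side_ex b w; have [t0 Ut0 [t0w Dt0]] := flip sds1 b_be.
have wT : pod v [:: x] w.
  by right; exists x, [::]; rewrite cats0 mem_head.
have t0T : trivial_on (pod v [:: x]) t0.
  exact: flip_near Ut0 t0w Dt0 (@pod_connected _ _) wT (no_recross_side NRx
    sds1).
have zT : pod v [:: rcons x b] z.
  by right; exists (rcons x b), [::]; rewrite cats0 mem_head zE.
have [t Gt tt0] := g1 t0 Ut0.
have podb : pod v [:: rcons x b] = z |` pod v [:: x] by rewrite pod_rcons.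
have tT : trivial_on (pod v [:: x]) t.
  by move=> p Tp; have [tp Dtp] := tt0 p ltac:(by rewrite podb; right);
    have [t0p Dt0p] := t0T p Tp; split; rewrite ?tp ?Dtp.
have tz : t z = z by have [] := trivial_step b (GU Gt) (tT w wT).
have Dtz : D t z = beta by rewrite (tt0 z zT).2; exact: flip_far sds1 Dt0.
have tzc : t (z * gen c) = y by rewrite (aut_obeys (U_aut (GU Gt))) tz Dtz.
move=> k Uk; have [g Gg gk] := g1 k Uk; have [h [Gh gK hK]] := G_inv Gg.
have divE q := agree_div q (U_aut (GU Gg)) gK hK (U_aut Uk).
pose k' := h \o k; have Uk' : U k' by apply: U_comp (GU Gh) Uk.
have k'T : trivial_on (pod v [:: rcons x b]) k' by move=> q /gk /divE.
have [k'zc k'c] := trivial_step c Uk' (k'T z zT).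
pose ga := D k' (z * gen c).
have [sd2 sds2] := side_ex c z; have [s0 Us0 [s0z Ds0]] := flip sds2 k'c.
have sd20 : forall p, pod v [:: rcons x b] p -> sd2 p = false.
  by apply: no_recross_side NR _; rewrite -zE.
have s0T : trivial_on (pod v [:: rcons x b]) s0.
  exact: flip_near Us0 s0z Ds0 (@pod_connected _ _) zT sd20.
(* As [beta c] differs from [c], the edge from [z] to [y] does not cross the flipped hyperplane. *)
have Ds0y : D s0 y = 1.
  by rewrite Ds0 sds2.2 (sd20 z zT) (negPf be_c).
have [s Gs ss0] := g3 s0 Us0.
have sy : trivial_at s y.
  have [s0y _] := trivial_step (beta c) Us0 (s0T z zT).
  have [|sy Dsy] := ss0 y.
    right; exists [:: beta c], [::].
    by rewrite cats0 !inE eqxx !orbT.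
  by split; rewrite ?sy ?Dsy.
have Dsz : D s (z * gen c) = ga.
  rewrite (ss0 _ _).2; first exact: flip_far sds2 Ds0.
  by right; exists [:: c], [::]; rewrite cats0 !inE eqxx !orbT.
have s_along : along (trivial_at s) v1 (rcons u b).
  have [_ /along_cons[_ h1]] : True /\ along (trivial_at s0) v (rcons x b).
    by split=> //; apply/trivial_pod1.
  apply/along_rev; rewrite -zE1 => u1 u2 uE.
  have [|sp Dsp] := ss0 (z * word u1).
    by right; exists u1, u2; rewrite -uE mem_head.
  have /along_rev/(_ u1 u2 uE) := h1; rewrite -zE1 => -[s0p Ds0p].
  by split; rewrite ?sp ?Dsp.
have sv : s v = v.
  have := trivial_step e (GU Gs) (along_start s_along).
  by rewrite /v1 racg_genK => -[].
have [t' [Gt' tK t'K]] := G_inv Gt; have [s' [Gs' sK s'K]] := G_inv Gs.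
pose q := s \o (t' \o (s' \o t)).
have Gq : G q by exact: (G_comp Gs (G_comp Gt' (G_comp Gs' Gt))).
have q_along : along (trivial_at q) v (rcons x b).
  have com p := local_commutator (GU Gt') t'K tK (GU Gs) sK s'K (p := p).
  have t'fix p : t p = p -> t' p = p by move=> tp; rewrite -[in LHS]tp tK.
  have tTb p : pod v [:: rcons x b] p -> t p = p.
    by rewrite podb => -[->//|/tT[]].
  have t_along : along (fun p => t p = p) v (rcons x b).
    move=> u1 u2 uE; apply: tTb; right.
    by exists u1, u2; rewrite -uE mem_head.
  apply/along_cons; split.
    have tv : trivial_at t v by apply: tT; left.
    have [qv Dq] := com v (t'fix _ tv.1) sv; split; rewrite // Dq.
    have -> : D t' v = 1.
      by rewrite -{1}tv.1 (local_comp_inv v (U_aut (GU Gt)) (U_aut (GU Gt')) tK)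
        tv.2 invg1.
    by rewrite comm1g.
  move=> u1 u2 uE; have [sp Dsp] := s_along u1 u2 uE.
  have tp : t (v1 * word u1) = v1 * word u1.
    have /along_cons[_ t_al] := t_along; exact: t_al uE.
  by have [qp Dq] := com _ (t'fix _ tp) sp; split; rewrite // Dq Dsp commg1.
have Dq : D q (z * gen c) = ga.
  have ta := U_aut (GU Gt); have t'a := U_aut (GU Gt').
  have sa := U_aut (GU Gs); have s'a := U_aut (GU Gs').
  have c1 := aut_comp s'a ta; have c2 := aut_comp t'a c1.
  rewrite /q (local_comp _ sa c2) (local_comp _ t'a c1) (local_comp _ s'a ta)
    /=.
  have s'y : s' y = y by rewrite -[in LHS]sy.1 sK.
  have Ds'y : D s' y = 1.
    by rewrite -{1}sy.1 (local_comp_inv y sa s'a sK) sy.2 invg1.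
  have t'y : t' y = z * gen c by rewrite -tzc tK.
  have Dt'y : D t' y = (D t (z * gen c))^-1.
    by rewrite -tzc (local_comp_inv _ ta t'a tK).
  by rewrite tzc s'y Ds'y t'y Dt'y Dsz mulg1 mulgV mul1g.
exists (g \o q); first exact: G_comp.
have gq p : agree_at q k' p -> agree_at (g \o q) k p.
  move=> qk; rewrite (_ : k = g \o k'); last by apply/funext => r /=;
    rewrite hK.
  by apply: agree_at_comp qk; [exact: U_aut (GU _)..|exact: U_aut].
have qT : trivial_on (pod v [:: rcons x b]) q by apply/trivial_pod1.
move=> p; rewrite pod_rcons -zE => -[->|Tp]; apply: gq.
  by have [qzc _] := trivial_step c (GU Gq) (qT z zT); split;
    rewrite ?qzc ?k'zc.
by have [qp Dqp] := qT p Tp; have [kp Dkp] := k'T p Tp; split;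
  rewrite ?qp ?kp ?Dqp ?Dkp.
Qed.

(** Paths of length at most two lie in a star, and recrossing paths can be shortened. If the last
    two labels are adjacent, the end is the fourth corner of a square whose other corners lie in a
    tripod; [straight_good] covers the rest. *)
Lemma word_good m v u : pods_good m -> size u <= m.+1 -> good (pod v [:: u]).
Proof.
move=> gm sz; case: (recross_factor u) => [[u1 [b [f [u2 [uE bf]]]]]|NR].
  by rewrite uE in sz *; exact: recross_good sz.
case/lastP: u NR sz => [|u c] NR sz.
  apply: (good_ext (star_good v)) => g _ gT; apply/trivial_pod1.
  by apply: along_nil; apply: gT; left.
case/lastP: u NR sz => [|u b] NR sz.
  apply: (good_ext (star_good v)) => g _ gT; apply/trivial_pod1.
  apply/along_cons; split; first by apply: gT; left.
  by apply: along_nil; apply: gT; right; exists c.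
case: u NR sz => [|e u] NR sz.
  apply: (good_ext (star_good (v * gen b))) => g _ gT; apply/trivial_pod1.
  apply/along_cons; split; first by apply: gT; right; exists b;
    rewrite racg_genK.
  apply/along_cons; split; first by apply: gT; left.
  by apply: along_nil; apply: gT; right; exists c.
case: (boolP (E b c)) => [bc|nbc]; last exact: straight_good NR nbc sz.
pose x := e :: u; pose y := v * word x.
have g3 : good (pod y [:: rev x; [:: b]; [:: c]]).
  rewrite /x rev_cons; apply: (@pod_three m y (rev u) [::] [::]
    e b c [::]) => //=.
  by move: sz; rewrite !size_cat /= !size_rcons /= size_rev; lia.
apply: (good_ext g3) => g Ug /trivial_pod/= h; apply/trivial_pod1.
have hx := (along_rev _ _ _).2 (h isT (rev x) (mem_head _ _)).
have hb := along_end (h isT [:: b] ltac:(by rewrite !inE eqxx orbT)).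
have hc := along_end (h isT [:: c] ltac:(by rewrite !inE eqxx !orbT)).
rewrite -!cats1 -catA -cat_cons; apply/along_cat; split=> //.
apply/along_cons; split; first exact: along_end hx.
apply/along_cons; split; first exact: hb.
by apply: along_nil; apply: (trivial_square Ug bc _ hb hc); exact: along_end hx.
Qed.

(** Two legs form one path read from the end of the first; three or more nonempty legs can each lose
    a last vertex, as in [three_leaves]. *)
Lemma pods_are_good m : pods_good m.
Proof.
elim: m => [|m IHm] v ws sz.
  apply: (good_sub (star_good v)) => p [->|[u1 [u2 [uws ->]]]]; left => //.
  have : size (u1 ++ u2) <= size (flatten ws).
    by case/splitPr: uws => w1 w2; rewrite flatten_cat /= !size_cat; lia.
  by case: u1 {uws} => [|a u1 /= h]; [rewrite racg_word_nil mulg1|move: sz h;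
    lia].
have {sz} : (size (flatten [seq u <- ws | u != [::]]) <= m.+1)%N.
  apply: leq_trans sz; elim: ws => //= u ws IH.
  by case: eqP => _ /=; rewrite !size_cat ?leq_add2l //; apply: (leq_trans IH);
    exact: leq_addl.
have sub : pod v ws `<=` pod v [seq u <- ws | u != [::]].
  move=> p [->|[u1 [u2 [uws ->]]]]; first by left.
  case: (eqVneq (u1 ++ u2) [::]) => [|u0].
    by case: u1 {uws} => // _; left; rewrite racg_word_nil mulg1.
  by right; exists u1, u2; rewrite mem_filter u0.
move=> sz; apply: good_sub sub; move: sz.
have : all (fun u => u != [::]) [seq u <- ws | u != [::]] by exact: filter_all.
case: [seq u <- ws | _] => [|u1 [|u2 [|u3 ws']]] ne sz.
- by apply: (good_sub (star_good v)) => p [->|[u1 [u2 []//]]]; left.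
- by move: sz; rewrite /= cats0; exact: word_good.
- have g12 : good (pod (v * word u1) [:: rev u1 ++ u2]).
    by apply: word_good IHm _; move: sz; rewrite /= cats0 !size_cat size_rev.
  apply: (good_ext g12) => g Ug /trivial_pod1/along_cat[h1].
  rewrite racg_wordV mulgK => h2; apply/trivial_pod => // u.
  by rewrite !inE => /orP[]/eqP-> //; exact/along_rev.
- move: ne sz => /and4P[].
  case/lastP: u1 => // u1 a1 _; case/lastP: u2 => // u2 a2 _.
  by case/lastP: u3 => // u3 a3 _ _; exact: pod_three.
Qed.

Lemma finite_good (S : seq W) : good [set` S].
Proof.
have [ws wsP] : exists ws : seq (seq V), forall p, p \in S -> pod 1 ws p.
  elim: S => [|p S [ws wsP]]; first by exists [::].
  have [u pu] := racg_word_ex p; exists (u :: ws) => q; rewrite in_cons.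
  case/orP=> [/eqP->|/wsP[->|[u1 [u2 [uws ->]]]]]; last 1 first.
  - by right; exists u1, u2; rewrite in_cons uws orbT.
  - by right; exists u, [::]; rewrite cats0 mem_head mul1g.
  - by left.
by apply: (good_sub (@pods_are_good _ 1 ws (leqnn _))) => p /wsP.
Qed.

End Pods.

(** * Flips far away, balls and stars *)

Lemma far_flip a b alpha (S : seq W) : b != a -> ~~ E a b ->
    alpha \in fixst a -> alpha != 1 ->
  exists t, [/\ U t, {in S, forall x, t x = x} & t <> id].
Proof.
move=> ba nab al al1.
(* [a] and [b] act on the integers as two reflections whose product is a      *)
(* translation, and the other generators trivially; the orbit of 0 separates  *)
(* the hyperplanes crossed at the steps [a] of the path [a b a b ...].        *)
pose f (c : V) (x : int) : int :=
  (if c == a then - x else if c == b then 1 - x else x)%R.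
have [|s c c' cc'|M [M1 MM]] := @racg_walk V E (int ->
  int) (fun s c => s \o f c) id.
- by move=> s c; apply/funext => x /=; congr (s _); rewrite /f; do 2?case: eqP;
  lia.
- apply/funext => x /=; congr (s _); rewrite /f.
  case: (eqVneq c a) cc' => [->|_]; case: (eqVneq c' a) => [->|_].
  + by rewrite Eirr.
  + by case: eqVneq => [->|]; [rewrite (negPf nab)|lia].
  + by case: (eqVneq c b) => [->|]; [rewrite Esym (negPf nab)|lia].
  + by case: (eqVneq c b) => [->|_]; case: eqVneq => [->|]; rewrite ?Eirr //;
    lia.
have Mpar w p : parallel a w p -> M p 0%R = M w 0%R.
  case=> u au ->; elim/last_ind: u au => [|u c IHu]; first by rewrite mulg1.
  rewrite all_rcons => /andP[ac /IHu <-]; rewrite racg_word_rcons mulgA MM /=.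
  congr (M _ _); rewrite /f; case: eqVneq ac => [_ _|ca /orP[/eqP/(elimN eqP
    ca)//|ac]]; first by lia.
  by case: eqVneq ac => // ->; rewrite (negPf nab).
have Mbound u x : (`|M (word u) x| <= `|x| + (count_mem b u)%:Z)%R.
  elim/last_ind: u x => [|u c IHu] x; first by rewrite racg_word_nil M1 /=; lia.
  rewrite racg_word_rcons MM /= -cats1 count_cat /=; have := IHu (f c x).
  rewrite /f; case: (eqVneq c a) => [->|_]; first
    by rewrite eq_sym (negPf ba); move: (M _ _) (count_mem b u) => y n; lia.
  by case: eqVneq => _; move: (M _ _) (count_mem b u) => y n; lia.
pose path N := iter N (fun u => u ++ [:: a; b]) [::].
have Mpath N x : M (word (path N)) x = (x - N%:Z)%R.
  elim: N x => [|N IHN] x; first by rewrite /path racg_word_nil M1; lia.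
  rewrite /path iterS racg_wordM !racg_word_cons racg_word_nil mulg1 mulgA !MM
    /= IHN.
  by rewrite /f eqxx (negPf ba) eqxx; lia.
have count_path N : count_mem b (path N) = N.
  by elim: N => //= N IHN; rewrite count_cat IHN /= eqxx eq_sym (negPf ba); lia.
have last_path N : (0 < N)%N -> last a (path N) = b.
  by case: N => // N _; rewrite /path iterS last_cat.
have [wS wSP] : exists wS : seq (seq V), forall p, p \in S ->
  exists2 u, u \in wS & p = word u.
  elim: S => [|p S [wS wSP]]; first by exists [::].
  have [u pu] := racg_word_ex p; exists (u :: wS) => q; rewrite in_cons.
  by case/orP=> [/eqP->|/wSP[v vw ->]]; [exists u | exists v];
    rewrite ?inE ?eqxx ?vw ?orbT.
(* A word ending on the carrier of the hyperplane at [w] needs at least [N] letters [b], more than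
   any word of [wS] has. *)
pose N := (size (flatten wS)).+1; pose w := word (path N).
have [sd sds] := side_ex a w.
have far h : parallel a w (word h) -> (N <= count_mem b h)%N.
  by move/Mpar => eM; have := Mbound h 0%R; rewrite eM Mpath; lia.
have no_cross u : u \in path N :: wS -> forall h h', u = h ++ a :: h' ->
    ~ parallel a w (word h).
  rewrite inE => /orP[/eqP->|uw] h h' uE /far; last first.
    have : (size u <= size (flatten wS))%N.
      by case/splitPr: uw => w1 w2; rewrite flatten_cat /= !size_cat; lia.
    rewrite uE size_cat /= => sh Nh; have := leq_trans Nh (count_size _ _).
    by rewrite /N; lia.
  have := count_path N; have := last_path N isT;
    rewrite uE last_cat count_cat /=.
  move=> lb; have := mem_last a h'; rewrite lb inE (negPf ba) /= -has_pred1
    has_count.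
  move=> h1 h2; apply/negP; rewrite -ltnNge -h2 -[X in (X < _)%N]addn0.
  by rewrite ltn_add2l addn_gt0 h1 orbT.
have sd1 : sd 1 = false.
  case sd1: (sd 1) => //; exfalso.
  have [|h [h' [hE]]] := side_cross (p := 1) (v := path N) sds.
    by rewrite mul1g sd1 sds.1.
  by rewrite mul1g; apply: no_cross hE; rewrite inE eqxx.
pose T := pod 1 (path N :: wS).
have sdT p : T p -> sd p = false.
  case=> [->//|[u1 [u2 [uw ->]]]]; rewrite mul1g.
  case sdu: (sd (word u1)) => //; exfalso.
  have [|h [h' [hE]]] := side_cross (p := 1) (v := u1) sds.
    by rewrite mul1g sd1 sdu.
  by rewrite mul1g; apply: (no_cross _ uw h (h' ++ u2)); rewrite hE -catA.
have Tw : T w by right; exists (path N), [::]; rewrite cats0 mul1g inE eqxx.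
have [t Ut [tw Dt]] := flip sds al.
have tT := flip_near Ut tw Dt (@pod_connected _ _) Tw sdT.
exists t; split=> // [x /wSP[u uw ->]|tid].
  by have [|//] := tT (word u); right; exists u, [::];
    rewrite cats0 mul1g inE uw orbT.
by have := flip_far sds Dt; rewrite tid local_id => /esym/eqP;
  rewrite (negPf al1).
Qed.

Lemma agree_nbrs (g h : W -> W) p : davis_aut g -> davis_aut h ->
  g p = h p -> (forall a, g (p * gen a) = h (p * gen a)) -> agree_at g h p.
Proof.
move=> ga ha gh ghn; split=> //; apply/permP => a.
by apply: (@racg_gen_eq _ _ (g p)); rewrite -(aut_obeys ga) gh -(aut_obeys ha).
Qed.

Lemma restrictionP v A :
  restriction (stabilizer G v) A = restriction (stabilizer U v) A <->
  forall u, U u -> u v = v ->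
    exists2 g, G g & g v = v /\ forall x, A x -> g x = u x.
Proof.
split=> [resE u Uu uv|h].
  have : restriction (stabilizer U v) A (sigL A u) by exists u.
  rewrite -resE => -[g [Gg gv] gu]; exists g => //; split=> // x Ax.
  by have /(congr1 (fun f => f (exist _ x (mem_set Ax)))) := gu.
apply/seteqP; split=> _ [g [Gg gv] <-]; first by exists g; split=> //;
  exact: GU.
have [k Gk [kv kg]] := h g Gg gv; exists k; first by split.
by apply/funext => -[x xA]; exact: (kg x (set_mem xA)).
Qed.

Lemma common_cubeP (x y : W) : common_cube x y ->
  [\/ y = x, exists a, y = x * gen a | exists a b,
    E a b /\ y = x * gen a * gen b].
Proof.
case=> C [[[v ->]|[v [a ->]]|[v [a [b [ab ->]]]]] Cx Cy].
- by rewrite Cx Cy; constructor 1.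
- case: Cx Cy => /= -> [] /= ->; try by constructor 1.
    by constructor 2; exists a.
  by constructor 2; exists a; rewrite racg_genK.
- case: (davis_square_base ab Cx Cy) => [[[/= ->|/= ->]|/= ->]|/= ->].
  + by constructor 1.
  + by constructor 2; exists a.
  + by constructor 2; exists b.
  + by constructor 3; exists a, b.
Qed.

Lemma common_cube_edge (x : W) a : common_cube x (x * gen a).
Proof.
exists (davis_edge x a); split; [|by left|by right].
by constructor 2; exists x, a.
Qed.

Lemma linf_ball_vstar (v p : W) n : linf_ball n v p ->
  vstar p `<=` linf_ball n.+1 v.
Proof.
case=> s [sn sp <-] q [->|[a ->]].
  by exists s; split=> //; exact: leqW.
exists (rcons s (last v s * gen a)); split; first by rewrite size_rcons.
  by rewrite rcons_path sp /=; apply/asboolP/common_cube_edge.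
by rewrite last_rcons.
Qed.

Lemma linf_ball0 (v : W) : linf_ball 0 v v.
Proof. by exists [::]. Qed.

Lemma trivial_cube u x y : U u -> trivial_at u x -> common_cube x y -> u y = y.
Proof.
move=> Uu ux /common_cubeP[->|[a ->]|[a [b [ab ->]]]]; first by case: ux.
  by have [] := trivial_step a Uu ux.
have [ua /fixstP[_ /(_ b)]] := trivial_step a Uu ux.
rewrite /in_star ab orbT => /(_ isT) fb.
by rewrite (aut_obeys (U_aut Uu)) ua fb.
Qed.

Lemma trivial_ball1 u v : U u -> trivial_at u v -> forall p, linf_ball 1 v p ->
  u p = p.
Proof.
move=> Uu uv p [[|x [|y s]] [//= _ xp <-]]; first by case: uv.
by move: xp; rewrite andbT => /asboolP; exact: trivial_cube.
Qed.

Lemma trivial_ball2 u v : U u -> trivial_on (vstar v) u ->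
  forall p, linf_ball 2 v p -> u p = p.
Proof.
move=> Uu uv p [s [ss sp <-]]; have uvv : trivial_at u v by apply: uv; left.
have star1 a : trivial_at u (v * gen a) by apply: uv; right; exists a.
case: s ss sp => [|x [|y [|z s]]] //= _; first by case: uvv.
  by rewrite andbT => /asboolP; exact: trivial_cube.
case/and3P=> /asboolP vx /asboolP xy _; apply: trivial_cube xy => //.
case/common_cubeP: vx => [->//|[a ->]//|[a [b [ab ->]]]].
exact: trivial_square.
Qed.

Hypothesis G_transitive : is_transitive G.

Lemma vstar_good_transport v w : good (vstar v) -> good (vstar w).
Proof.
move=> gv u Uu; have [h Gh hv] := G_transitive v w.
have [h' [Gh' hK h'K]] := G_inv Gh.
have [g Gg gu] := gv (u \o h) (U_comp Uu (GU Gh)).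
exists (g \o h'); first exact: G_comp.
move=> p wp; have vp : vstar v (h' p).
  case: wp => [->|[a ->]]; first by left; rewrite -hv hK.
  right; exists (D h' w a); rewrite (aut_obeys (U_aut (GU Gh'))).
  by congr (_ * _); rewrite -hv hK.
have [gp Dgp] := gu _ vp; rewrite /agree_at.
rewrite (local_comp _ (U_aut (GU Gg)) (U_aut (GU Gh'))) Dgp /= gp /= h'K;
  split=> //.
rewrite (local_comp _ (U_aut Uu) (U_aut (GU Gh))) h'K mulgA.
by rewrite -{1}[p]h'K (local_comp_inv _ (U_aut (GU Gh)) (U_aut (GU Gh')) hK)
  mulVg mul1g.
Qed.

(** The local action at a vertex of the star is read off from its neighbours, and these lie in the
    ball of radius 2. *)
Lemma vstar_good_of_ball2 v :
  restriction (stabilizer G v) (linf_ball 2 v) =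
    restriction (stabilizer U v) (linf_ball 2 v) ->
  forall w, good (vstar w).
Proof.
move=> /restrictionP resE w; apply: (@vstar_good_transport v) => u Uu.
have [h Gh huv] := G_transitive (u v) v; have [h' [Gh' hK h'K]] := G_inv Gh.
have [g Gg [gv gu]] := resE _ (U_comp (GU Gh) Uu) huv.
exists (h' \o g); first exact: G_comp.
have uE : u = h' \o (h \o u) by apply/funext => x /=; rewrite hK.
move=> p vp; rewrite uE.
have ha := U_aut (GU Gh); have h'a := U_aut (GU Gh'); have ga := U_aut (GU Gg).
apply: agree_at_comp => //; first exact: aut_comp ha (U_aut Uu).
have bp : linf_ball 1 v p by apply: (linf_ball_vstar (linf_ball0 v)).
apply: agree_nbrs => //; first exact: aut_comp ha (U_aut Uu).
  by apply: gu; apply: (linf_ball_vstar bp); left.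
by move=> a; apply: gu; apply: (linf_ball_vstar bp); right; exists a.
Qed.

Lemma good_trivial T u : good T -> U u -> exists g g',
  [/\ G g, cancel g g', cancel g' g, U (g' \o u) & trivial_on T (g' \o u)].
Proof.
move=> gT Uu; have [g Gg gu] := gT u Uu; have [g' [Gg' gK g'K]] := G_inv Gg.
exists g, g'; split=> //; first exact: U_comp (GU Gg') Uu.
by move=> p /gu /(agree_div p (U_aut (GU Gg)) gK g'K (U_aut Uu)).
Qed.

Lemma ball2_of_vstar_good v : good (vstar v) ->
  restriction (stabilizer G v) (linf_ball 2 v) =
    restriction (stabilizer U v) (linf_ball 2 v).
Proof.
move=> gv; apply/restrictionP => u Uu uv.
have [g [g' [Gg gK g'K Ug'u triv]]] := good_trivial gv Uu.
have gu p : g' (u p) = p -> g p = u p by move=> {1}<-; rewrite g'K.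
exists g => //; split; first by rewrite (gu v (triv v (or_introl erefl)).1).
by move=> p /(trivial_ball2 Ug'u triv)/gu.
Qed.

Hypothesis F_simple : forall a, simple (fixst a).
Hypothesis F_transitive : forall a b, exists2 s, s \in F & s a = b.
(* An element of [G] fixing [v] and acting there as [s] can be corrected so   *)
(* as to commute with the local actions at [v a] of the elements of [G] that  *)
(* are trivial at [v], while it cannot commute with those at [v b].           *)
Definition separated_labels a b := exists s,
  [/\ s \in F, s a = a, s b = b, forall al, al \in fixst a -> commute s al
    & forall be, be \in fixst b -> exists2 ga,
      ga \in fixst b & ~ commute (be * s) ga].
Hypothesis F_indep : forall R : V -> V -> Prop,
  (forall a b, R a b -> R b a) -> (forall a b c, R a b -> R b c -> R a c) ->
  (forall s a b, s \in F -> R a b -> R (s a) (s b)) ->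
  (forall a b, separated_labels a b -> ~ R a b) ->
  forall a b, R a b -> a = b.

(** * Projections of the elements of [G] trivial at a vertex *)

Section NonDiscrete.
Hypothesis G_local : forall v s, s \in F -> exists2 g,
  G g & g v = v /\ D g v = s.

Lemma local_conj g g' k p : U g -> cancel g g' -> cancel g' g -> U k ->
    g p = p -> k p = p ->
  let c := (g : W -> W) \o (k \o g') in c p = p /\ D c p = D k p ^ D g p.
Proof.
move=> Ug gK g'K Uk gp kp c; have ga := U_aut Ug; have ka := U_aut Uk.
have g'a := aut_inv ga gK g'K; have g'p : g' p = p by rewrite -[in LHS]gp gK.
split; first by rewrite /c /= g'p kp gp.
have Dg' : D g' p = (D g p)^-1 by rewrite -(local_comp_inv p ga g'a gK) gp.
rewrite /c (local_comp p ga (aut_comp ka g'a)) (local_comp p ka g'a) /=.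
by rewrite g'p kp Dg' conjgE mulgA.
Qed.

Lemma simple_image (P : (W -> W) -> Prop) v a :
    P id -> (forall k l, P k -> P l -> P (k \o l)) ->
    (forall k, P k -> G k /\ trivial_at k v) ->
    (forall k de, P k -> de \in fixst a ->
       exists2 l, P l & D l (v * gen a) = D k (v * gen a) ^ de) ->
  (forall k, P k -> D k (v * gen a) = 1) \/
  (forall al, al \in fixst a -> exists2 k, P k & D k (v * gen a) = al).
Proof.
move=> Pid Pcomp PG Pconj.
pose A := [set al in fixst a | `[< exists2 k, P k & D k (v * gen a) = al
  >]]%SET.
have AP al : al \in A -> exists2 k, P k & D k (v * gen a) = al.
  by rewrite inE => /andP[_ /asboolP].
have PA k : P k -> D k (v * gen a) \in A.
  move=> Pk; rewrite inE; apply/andP; split; last by apply/asboolP; exists k.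
  by have [Gk kv] := PG k Pk; have [] := trivial_step a (GU Gk) kv.
have gA : group_set A.
  apply/group_setP; split=> [|_ _ /AP[k Pk <-] /AP[l Pl <-]].
    by rewrite -(local_id (v * gen a)); exact: PA.
  have [Gk kv] := PG k Pk; have [Gl lv] := PG l Pl.
  have [kva _] := trivial_step a (GU Gk) kv.
  rewrite -[X in _ * D l X]kva -(local_comp _ (U_aut (GU Gl)) (U_aut (GU Gk))).
  exact/PA/Pcomp.
have /simpleP[_ /(_ (Group gA))] := F_simple a.
case=> [|A1|AF].
- apply/andP; split.
    by apply/fintype.subsetP => al; rewrite inE => /andP[].
  apply/fintype.subsetP => de de_a; rewrite inE; apply/fintype.subsetP => x.
  case/finset.imsetP=> _ /AP[k Pk <-] ->.
  by have [l Pl <-] := Pconj k de Pk de_a; exact: PA.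
- by left=> k /PA; rewrite -[A]/(gval (Group gA)) A1 => /set1P.
- by right=> al; rewrite -AF => /AP.
Qed.

(** Normality: conjugate by an element of [G] that fixes [v * gen a] and acts there as [de]. It
    fixes [v] too, because [de] fixes [a]. *)
Lemma stab_image v a :
  (forall k, G k -> trivial_at k v -> D k (v * gen a) = 1) \/
  (forall al, al \in fixst a ->
     exists2 k, G k & trivial_at k v /\ D k (v * gen a) = al).
Proof.
have [||||h|h] := @simple_image (fun k => G k /\ trivial_at k v) v a.
- by split; [case: G_subgroup | exact: trivial_at_id].
- move=> k l [Gk kv] [Gl lv]; split; first exact: G_comp.
  by apply: trivial_comp => //; exact: U_aut (GU _).
- by [].
- move=> k de [Gk kv] /fixstP[deF de_fix].
  have [g Gg [gva Dg]] := G_local (v * gen a) deF.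
  have [g' [Gg' gK g'K]] := G_inv Gg.
  have [kva _] := trivial_step a (GU Gk) kv.
  have gv : g v = v.
    rewrite -{1}(racg_genK a v) (aut_obeys (U_aut (GU Gg))) gva Dg.
    by rewrite de_fix ?racg_genK // /in_star eqxx.
  have conj p := local_conj (GU Gg) gK g'K (GU Gk) (p := p).
  exists (g \o (k \o g')); last by rewrite (conj _ gva kva).2 Dg.
  split; first exact: (G_comp Gg (G_comp Gk Gg')).
  by have [cv Dc] := conj v gv kv.1; split; rewrite // Dc kv.2 conj1g.
- by left=> k Gk kv; exact: h.
- by right=> al /h[k [Gk kv] Dk]; exists k.
Qed.

(** Transitivity on vertices and labels spreads triviality to all edges. An element of [G] trivial
    at [v] is then the identity, so the values on [v] and its neighbours determine elements of
    [G]. *)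
Lemma discrete_of_trivial v a :
  (forall k, G k -> trivial_at k v -> D k (v * gen a) = 1) -> is_discrete G.
Proof.
move=> triv; have triv_all w b k : G k -> trivial_at k w -> D k (w * gen b) = 1.
  move=> Gk kw; have [h Gh hv] := G_transitive v w.
  have [s sF sa] := F_transitive a ((D h v)^-1 b).
  have [g Gg [gv Dg]] := G_local v sF.
  have Gq : G (h \o g) by exact: G_comp.
  have [q' [Gq' qK q'K]] := G_inv Gq; set q := h \o g in qK q'K Gq.
  have qa := U_aut (GU Gq); have q'a := U_aut (GU Gq');
    have ka := U_aut (GU Gk).
  have qv : q v = w by rewrite /q /= gv.
  have q'w : q' w = v by rewrite -qv qK.
  have Dq : D q v a = b.
    by rewrite (local_comp v (U_aut (GU Gh)) (U_aut (GU Gg))) permM gv Dg sa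
      permKV.
  have qva : q (v * gen a) = w * gen b by rewrite (aut_obeys qa) qv Dq.
  have c1 := aut_comp ka qa.
  have [kwb _] := trivial_step b (GU Gk) kw.
  have cv : trivial_at (q' \o (k \o q)) v.
    split; first by rewrite /= qv kw.1.
    rewrite (local_comp v q'a c1) (local_comp v ka qa) /= qv kw.1 kw.2 mulg1.
    by rewrite -qv (local_comp_inv v qa q'a qK) mulgV.
  have := triv _ (G_comp Gq' (G_comp Gk Gq)) cv.
  rewrite (local_comp _ q'a c1) (local_comp _ ka qa) /= qva kwb.
  rewrite -{2}qva (local_comp_inv _ qa q'a qK) => e.
  by apply: (@mulgI _ (D q (v * gen a))); apply: (mulIg (D q (v * gen a))^-1);
    rewrite e mulg1 mulgV.
apply/discreteP => g Gg; exists (v :: [seq v * gen b | b <- enum V]) => h Gh hg.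
have [g' [Gg' gK g'K]] := G_inv Gg.
have hgv : agree_at g h v.
  apply: agree_nbrs; [exact: U_aut (GU _)..| |].
    by rewrite hg ?mem_head.
  by move=> b; rewrite hg // in_cons (map_f (fun b => v * gen b)) ?orbT //
    mem_enum.
have /(agree_div v (U_aut (GU Gg)) gK g'K (U_aut (GU Gh))) kv := hgv.
pose k := g' \o h; have Gk : G k by exact: G_comp.
have k_triv p : trivial_at k (v * p).
  elim/racg_rind: p => [|p b IHp]; first by rewrite mulg1.
  by rewrite mulgA; exact: (trivial_step_at (GU Gk) IHp (triv_all _ b _ Gk
    IHp)).
apply/funext => x; have [kx _] := k_triv (v^-1 * x).
by move: kx; rewrite mulKVg /k /= => {2}<-; rewrite g'K.
Qed.

Hypothesis G_nondiscrete : ~ is_discrete G.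

Lemma stab_onto v a al : al \in fixst a ->
  exists2 k, G k & trivial_at k v /\ D k (v * gen a) = al.
Proof. by have [/discrete_of_trivial//|] := stab_image v a; apply. Qed.

Lemma stab_nontrivial v a : exists k,
  [/\ G k, trivial_at k v & D k (v * gen a) <> 1].
Proof.
have /simpleP[F1 _] := F_simple a.
have /trivgPn[al al_a al1] := F1; have [k Gk [kv Dk]] := stab_onto v al_a.
by exists k; split=> //; rewrite Dk; exact/eqP.
Qed.

(** Inclusion of the kernel of the projection at [a] in that at [b]. *)
Definition stab_le v a b := forall k, G k -> trivial_at k v ->
  D k (v * gen a) = 1 -> D k (v * gen b) = 1.

Lemma stab_le_image v a b : stab_le v b a \/
  (forall al, al \in fixst a -> exists2 k, G k &
     [/\ trivial_at k v, D k (v * gen b) = 1 & D k (v * gen a) = al]).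
Proof.
have [||||h|h] := @simple_image
    (fun k => [/\ G k, trivial_at k v & D k (v * gen b) = 1]) v a.
- by split; [case: G_subgroup | exact: trivial_at_id | exact: local_id].
- move=> k l [Gk kv kb] [Gl lv lb]; split; first exact: G_comp.
    by apply: trivial_comp => //; exact: U_aut (GU _).
  rewrite (local_comp _ (U_aut (GU Gk)) (U_aut (GU Gl))) lb.
  by have [-> _] := trivial_step b (GU Gl) lv; rewrite kb mulg1.
- by move=> k [].
- move=> k de [Gk kv kb] /(stab_onto v)[g Gg [gv Dg]].
  have [g' [Gg' gK g'K]] := G_inv Gg.
  have conj p := local_conj (GU Gg) gK g'K (GU Gk) (p := p).
  have [kva _] := trivial_step a (GU Gk) kv; have [gva _] :=
    trivial_step a (GU Gg) gv.
  have [kvb _] := trivial_step b (GU Gk) kv; have [gvb _] :=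
    trivial_step b (GU Gg) gv.
  exists (g \o (k \o g')); last by rewrite (conj _ gva kva).2 Dg.
  split; first exact: (G_comp Gg (G_comp Gk Gg')).
    by have [cv Dc] := conj v gv.1 kv.1; split; rewrite // Dc kv.2 conj1g.
  by rewrite (conj _ gvb kvb).2 kb conj1g.
- by left=> k Gk kv kb; exact: h.
- by right=> al /h[k [Gk kv kb] Dk]; exists k.
Qed.

(** Otherwise the kernel at [b] maps onto [fixst a]. Divide some [k] nontrivial at [b] by an element
    of that kernel with the same action at [a]: the quotient is trivial at [a] but not at [b]. *)
Lemma stab_le_sym v a b : stab_le v a b -> stab_le v b a.
Proof.
move=> ab; have [//|onto] := stab_le_image v a b; exfalso.
have [k [Gk kv kb]] := stab_nontrivial v b; apply: kb.
have [kva ka] := trivial_step a (GU Gk) kv; have [l Gl [lv lb la]] := onto _ ka.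
have [l' [Gl' lK l'K]] := G_inv Gl.
have laa := U_aut (GU Gl); have l'aa := U_aut (GU Gl');
  have kaa := U_aut (GU Gk).
have divE p := agree_div p laa lK l'K kaa.
have tv : trivial_at (l' \o k) v.
  by apply/divE; split; rewrite ?kv.1 ?kv.2 ?lv.1 ?lv.2.
have ta : D (l' \o k) (v * gen a) = 1.
  have /divE[] // : agree_at l k (v * gen a).
  by split=> //; rewrite kva; have [] := trivial_step a (GU Gl) lv.
have := ab _ (G_comp Gl' Gk) tv ta.
have [kvb _] := trivial_step b (GU Gk) kv; have [lvb _] :=
  trivial_step b (GU Gl) lv.
have l'b : D l' (v * gen b) = 1.
  by rewrite -{1}lvb (local_comp_inv _ laa l'aa lK) lb invg1.
by rewrite (local_comp _ l'aa kaa) kvb l'b mulg1.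
Qed.

Lemma stab_le_perm v s a b : s \in F -> stab_le v a b -> stab_le v (s a) (s b).
Proof.
move=> sF ab k Gk kv ksa; have [g Gg [gv Dg]] := G_local v sF.
have [g' [Gg' gK g'K]] := G_inv Gg.
have ga := U_aut (GU Gg); have g'a := U_aut (GU Gg'); have ka := U_aut (GU Gk).
have c1 := aut_comp ka ga.
have gvc c : g (v * gen c) = v * gen (s c) by rewrite (aut_obeys ga) gv Dg.
have conj c : D (g' \o (k \o g)) (v * gen c) =
    D g (v * gen c) * D k (v * gen (s c)) * (D g (v * gen c))^-1.
  have [ksc _] := trivial_step (s c) (GU Gk) kv.
  rewrite (local_comp _ g'a c1) (local_comp _ ka ga) /= gvc ksc.
  by rewrite -{2}gvc (local_comp_inv _ ga g'a gK).
have cv : trivial_at (g' \o (k \o g)) v.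
  have g'v : g' v = v by rewrite -[in LHS]gv gK.
  split; first by rewrite /= gv kv.1.
  rewrite (local_comp v g'a c1) (local_comp v ka ga) /= gv kv.1 kv.2 mulg1.
  by rewrite -{2}gv (local_comp_inv v ga g'a gK) mulgV.
have := ab _ (G_comp Gg' (G_comp Gk Gg)) cv.
rewrite !conj ksa mulg1 mulgV => /(_ erefl) e.
apply: (@mulgI _ (D g (v * gen b))); apply: (mulIg (D g (v * gen b))^-1).
by rewrite e mulg1 mulgV.
Qed.

(** The commutator of [q], acting as [s] at [v * gen a], with a suitable [l] trivial at [v] is
    trivial at [v] and [v * gen a], but not at [v * gen b]. *)
Lemma separated_stab_le v a b : separated_labels a b -> ~ stab_le v a b.
Proof.
case=> s [sF sa sb s_com s_ncom] ab; have [g Gg [gv Dg]] := G_local v sF.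
have gaa := U_aut (GU Gg).
have step c := U_step v c (GU Gg); rewrite Dg in step.
have [k Gk [kv Dk]] := stab_onto v (groupVr (step a)).
pose q := g \o k; have Gq : G q by exact: G_comp.
have kaa := U_aut (GU Gk).
have qv : q v = v by rewrite /q /= kv.1.
have qvc c : s c = c -> q (v * gen c) = v * gen c.
  move=> sc; have [kvc _] := trivial_step c (GU Gk) kv.
  by rewrite /q /= kvc (aut_obeys gaa) gv Dg sc.
have Dqa : D q (v * gen a) = s.
  have [kva _] := trivial_step a (GU Gk) kv.
  by rewrite (local_comp _ gaa kaa) kva Dk invMg invgK mulgKV.
have [be be_b Dqb] : exists2 be, be \in fixst b & D q (v * gen b) = be * s.
  exists (D q (v * gen b) * s^-1); last by rewrite mulgKV.
  have [kvb kb] := trivial_step b (GU Gk) kv.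
  by rewrite (local_comp _ gaa kaa) kvb -mulgA groupM.
have [ga ga_b] := s_ncom be be_b; apply.
have [l Gl [lv Dl]] := stab_onto v ga_b.
have [q' [Gq' qK q'K]] := G_inv Gq; have [l' [Gl' lK l'K]] := G_inv Gl.
have com p := local_commutator (GU Gq) qK q'K (GU Gl) lK l'K (p := p).
have Gc := G_comp Gl (G_comp Gq (G_comp Gl' Gq')).
have [lva la] := trivial_step a (GU Gl) lv.
have [lvb _] := trivial_step b (GU Gl) lv.
have [cv Dcv] := com v qv lv.1; rewrite lv.2 commg1 in Dcv.
have [_ Dca] := com _ (qvc a sa) lva; have [_ Dcb] := com _ (qvc b sb) lvb.
have := ab _ Gc (conj cv Dcv).
rewrite Dca Dcb Dqa Dqb Dl => /(_ _)/eqP/commgP; apply.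
by apply/eqP/commgP/s_com.
Qed.

Lemma stab_le_eq v a b : stab_le v a b -> a = b.
Proof.
apply: F_indep => [x y|x y z xy yz k Gk kv /(xy k Gk kv)/yz|s x y|x y].
- exact: stab_le_sym.
- exact.
- exact: stab_le_perm.
- exact: separated_stab_le.
Qed.

(** Pairwise independence and perfectness allow a prescribed action at one neighbour with triviality
    at all the others; the neighbours are then corrected one by one. *)
Lemma vstar_good_of_nondiscrete v : good (vstar v).
Proof.
have fill a al : al \in fixst a -> exists2 s, G s &
    [/\ trivial_at s v, forall b, b != a -> trivial_at s (v * gen b)
      & D s (v * gen a) = al].
  move=> al_a; pose Y := [seq v * gen b | b <- enum V & b != a].
  have [||||s Gs [sT Ds]] := @commutator_fill [set v] v a Y _ _ _ _ al al_a.
  - by [].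
  - by move=> _ /mapP[b _ ->]; exists v, b.
  - by move=> be /(stab_onto v)[k Gk [kv Dk]]; exists k => //; split=> // _ ->.
  - move=> _ /mapP[b + ->] be be_a; rewrite mem_filter => /andP[ba _].
    have [/stab_le_eq/eqP|] := stab_le_image v a b; first by rewrite (negPf ba).
    case/(_ be be_a) => k Gk [kv kb ka]; exists k => //; split=> // _ [->|->//].
    exact: trivial_step_at (GU Gk) kv kb.
  - exists s => //; split=> // [|b ba]; first by apply: sT; left.
    by apply: sT; right; apply/mapP; exists b;
      rewrite // mem_filter ba mem_enum.
move=> u Uu; have [h Gh hv] := G_transitive v (u v).
have [h' [Gh' hK h'K]] := G_inv Gh.
have haa := U_aut (GU Gh); have h'aa := U_aut (GU Gh'); have uaa := U_aut Uu.
have Uhu : U (h' \o u) by exact: U_comp (GU Gh') Uu.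
have [k0 Gk0 [k0v Dk0]] := G_local v (U_local v Uhu).
have seqs (l : seq V) : exists2 g, G g &
    agree_at g u v /\ forall a, a \in l -> agree_at g u (v * gen a).
  elim: l => [|a l [g Gg [gv gl]]].
    exists (h \o k0); first exact: G_comp.
    split=> //; rewrite (_ : u = h \o (h' \o u)); last first.
      by apply/funext => x /=; rewrite h'K.
    apply: agree_at_comp => //; [exact: U_aut (GU _)|exact: U_aut|].
    by split=> //; rewrite k0v /= -hv hK.
  case: (boolP (a \in l)) => [al|nal].
    by exists g => //; split=> // b; rewrite inE => /orP[/eqP->|]; exact: gl.
  have [g' [Gg' gK g'K]] := G_inv Gg.
  have gaa := U_aut (GU Gg).
  have divE p := agree_div p gaa gK g'K uaa.
  have Ugu : U (g' \o u) by exact: U_comp (GU Gg') Uu.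
  have guv : trivial_at (g' \o u) v by apply/divE.
  have [guva gua] := trivial_step a Ugu guv.
  have [s Gs [sv sb sa]] := fill a _ gua.
  have saa := U_aut (GU Gs).
  have gsu p : agree_at s (g' \o u) p -> agree_at (g \o s) u p.
    move=> su; rewrite (_ : u = g \o (g' \o u)); last first.
      by apply/funext => x /=; rewrite g'K.
    by apply: agree_at_comp su => //; exact: U_aut.
  have gsu' p : trivial_at s p -> trivial_at (g' \o u) p ->
    agree_at (g \o s) u p.
    by move=> [sp Dsp] [gup Dgup]; apply: gsu; split;
      rewrite ?sp ?gup ?Dsp ?Dgup.
  exists (g \o s); first exact: G_comp.
  split=> [|b]; first exact: gsu'.
  rewrite inE => /orP[/eqP->|bl].
    by apply: gsu; split=> //; rewrite guva; have [] :=
      trivial_step a (GU Gs) sv.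
  have ba : b != a by apply: contraNneq nal => <-.
  by apply: gsu'; [exact: sb | apply/divE; exact: gl].
have [g Gg [gv gl]] := seqs (enum V); exists g => // p [->//|[a ->]].
by apply: gl; rewrite mem_enum.
Qed.

End NonDiscrete.

(** A constant family of local actions is compatible, so [U] fixes [v] with any prescribed action
    there; radius 1 transfers this to [G], and conjugation carries it to [w]. *)
Lemma local_onto_of_ball1 v :
  restriction (stabilizer G v) (linf_ball 1 v) =
    restriction (stabilizer U v) (linf_ball 1 v) ->
  forall w s, s \in F -> exists2 g, G g & g w = w /\ D g w = s.
Proof.
move=> /restrictionP resE w s sF.
have [h Gh hv] := G_transitive v w; have [h' [Gh' hK h'K]] := G_inv Gh.
have haa := U_aut (GU Gh); have h'aa := U_aut (GU Gh').
pose r := s ^ (D h v)^-1.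
have rF : r \in F by rewrite groupJ ?groupV ?U_local //; exact: GU.
have [u [ua uv Du]] := @compatible_aut V E Esym (fun=> r) v
  (conj (fun _ _ _ => F_aut _ _ rF) (fun _ _ _ _ => erefl)).
have Uu : U u by split=> // p; rewrite Du.
have [g Gg [gv gu]] := resE u Uu uv.
have gaa := U_aut (GU Gg).
have Dg : D g v = r.
  rewrite -(Du v); apply: (agree_nbrs gaa ua _ _).2; first by rewrite gv uv.
  move=> a; apply: gu; apply: (linf_ball_vstar (linf_ball0 v)).
  by right; exists a.
exists (h \o (g \o h')); first exact: (G_comp Gh (G_comp Gg Gh')).
have h'w : h' w = v by rewrite -hv hK.
split; first by rewrite /= h'w gv hv.
rewrite (local_comp _ haa (aut_comp gaa h'aa)) (local_comp _ gaa h'aa) /= h'w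
  gv.
rewrite -[in D h' _]hv (local_comp_inv v haa h'aa hK) Dg /r conjgE invgK.
by rewrite !mulgA mulVg mul1g mulgKV.
Qed.

Theorem dense_tfae (a0 b0 : V) : b0 != a0 -> ~~ E a0 b0 ->
  [<-> is_dense_in G U;
       ~ is_discrete G /\
       exists v, restriction (stabilizer G v) (linf_ball 1 v) =
                 restriction (stabilizer U v) (linf_ball 1 v);
       exists v, restriction (stabilizer G v) (linf_ball 2 v) =
                 restriction (stabilizer U v) (linf_ball 2 v)].
Proof.
move=> ba0 nab0; tfae.
- move=> /dense_inP dG; split.
    move=> /discreteP/(_ id)[|S Sid]; first by case: G_subgroup.
    have /simpleP[/trivgPn[al al_a al1] _] := F_simple a0.
    have [t [Ut tS tid]] := far_flip S ba0 nab0 al_a al1.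
    have [x tx] : exists x, t x <> x.
      by apply: contrapT => /forallNP h; apply: tid; apply/funext => x;
        exact: contrapT (h x).
    have [g Gg gt] := dG t (x :: S) Ut.
    apply: tx; rewrite -gt ?mem_head // (Sid g Gg) // => y yS.
    by rewrite gt ?tS // inE yS orbT.
  exists 1; apply/restrictionP => u Uu u1.
  (* Agreement at a vertex and its neighbours gives equal local actions there, hence agreement on
     the whole ball. *)
  have [g Gg gu] := dG u (1 :: [seq 1 * gen a | a <- enum V]) Uu.
  have [g' [Gg' gK g'K]] := G_inv Gg.
  have gu1 : agree_at g u 1.
    apply: agree_nbrs; [exact: U_aut (GU _)|exact: U_aut| |].
      by rewrite gu ?mem_head.
    by move=> a; apply: gu; rewrite in_cons (map_f (fun b => 1 * gen b)) ?orbT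
      // mem_enum.
  exists g => //; split=> [|p bp]; first by rewrite gu1.1.
  have := (agree_div 1 (U_aut (GU Gg)) gK g'K (U_aut Uu)).1 gu1.
  move/(trivial_ball1 (U_comp (GU Gg') Uu))/(_ p bp) => /= {1}<-.
  by rewrite g'K.
- move=> [ndG [v /local_onto_of_ball1 loc]]; exists v.
  exact/ball2_of_vstar_good/vstar_good_of_nondiscrete.
- move=> [v /vstar_good_of_ball2 sg]; apply/dense_inP => u S Uu.
  by have [g Gg gu] := finite_good sg S Uu; exists g => // x xS;
    have [] := gu x xS.
Qed.

End UniversalGroup.

(** * The alternating group acting on the odd graph *)

Local Close Scope classical_set_scope.

(** * Even permutations supported on a subset *)

Section ExtendPerm.
Import boot.fintype boot.finset.
Variables (T : finType) (A : {set T}).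
Local Notation S := {x | x \in A}.

Definition ext_fun (s : {perm S}) (x : T) : T :=
  if insub x is Some y then val (s y) else x.

Lemma ext_fun_in s (y : S) : ext_fun s (val y) = val (s y).
Proof. by rewrite /ext_fun valK. Qed.

Lemma ext_fun_out s x : x \notin A -> ext_fun s x = x.
Proof. by move=> xA; rewrite /ext_fun insubN. Qed.

Lemma ext_fun_inj s : injective (ext_fun s).
Proof.
apply: (@can_inj _ _ _ (ext_fun s^-1)) => x; case: (boolP (x \in A)) => xA.
  by rewrite -[x]/(val (Sub x xA : S)) !ext_fun_in permK.
by rewrite !ext_fun_out.
Qed.

Definition ext_perm (s : {perm S}) : {perm T} := perm (@ext_fun_inj s).

Lemma ext_perm_in s (y : S) : ext_perm s (val y) = val (s y).
Proof. by rewrite permE ext_fun_in. Qed.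

Lemma ext_perm_out s x : x \notin A -> ext_perm s x = x.
Proof. by rewrite permE; exact: ext_fun_out. Qed.

Lemma ext_permM : {morph ext_perm : s t / s * t}.
Proof.
move=> s t; apply/permP => x; rewrite permM; case: (boolP (x \in A)) => xA.
  by rewrite -[x]/(val (Sub x xA : S)) !ext_perm_in permM.
by rewrite !ext_perm_out.
Qed.

Lemma ext_perm_on s : perm_on A (ext_perm s).
Proof.
apply/subsetP => x; rewrite inE; apply: contraR => xA.
by rewrite ext_perm_out.
Qed.

Lemma ext_perm_inj : injective ext_perm.
Proof.
move=> s t st; apply/permP => y; apply: val_inj.
by rewrite -!ext_perm_in st.
Qed.

Lemma ext_tperm (x y : S) : ext_perm (tperm x y) = tperm (val x) (val y).
Proof.
apply/permP => z; case: (boolP (z \in A)) => zA.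
  rewrite -[z]/(val (Sub z zA : S)) ext_perm_in.
  case: (tpermP x y) => [<-|<-|/eqP zx /eqP zy]; rewrite /= ?tpermL ?tpermR //.
  rewrite tpermD //; [apply: contraNneq zx | apply: contraNneq zy] => e;
    exact/eqP/val_inj.
rewrite ext_perm_out // tpermD //; apply: contraNneq zA => <-; exact: valP.
Qed.

Lemma odd_ext_perm s : odd_perm (ext_perm s) = odd_perm s.
Proof.
have [ts -> _] := prod_tpermP s; elim: ts => [|t ts IH].
  rewrite !big_nil; suff -> : ext_perm 1 = 1 by rewrite !odd_perm1.
  by apply: (@mulgI _ (ext_perm 1)); rewrite -ext_permM !mulg1.
by rewrite !big_cons ext_permM !odd_permM IH ext_tperm !odd_tperm (inj_eq
  val_inj).
Qed.

Lemma ext_perm_onto t : perm_on A t -> exists s, ext_perm s = t.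
Proof.
move=> tA; have tin (y : S) : t (val y) \in A by rewrite (perm_closed _ tA)
  (valP y).
pose f (y : S) : S := Sub (t (val y)) (tin y).
have fI : injective f.
  by move=> y z /(congr1 val) /perm_inj /val_inj.
exists (perm fI); apply/permP => x; case: (boolP (x \in A)) => xA.
  by rewrite -[x]/(val (Sub x xA : S)) ext_perm_in permE.
by rewrite ext_perm_out // (out_perm tA).
Qed.

End ExtendPerm.

Lemma exists2_card (T : finType) (A : {set T}) : (1 < #|A|)%N ->
  exists x y, [/\ x \in A, y \in A & x != y].
Proof. by move/card_gt1P=> [x [y [xA yA xy]]]; exists x, y. Qed.

(** * Stabilizers of stars and separation of labels in the Odd graph *)

Section OddGraphGroup.
Import boot.fintype boot.finset.
Variable d : nat.
Hypothesis hd : (6 <= d)%N.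
Local Notation n := (2 * d - 1)%N.
Local Notation V := (odd_vertex d).
Local Notation E := (@odd_adj d).
Local Notation op := (@odd_perm_of d).

Lemma card_odd (a : V) : #|val a| = (d - 1)%N.
Proof. exact/eqP/(valP a). Qed.

Lemma odd_sym : symmetric E.
Proof. by move=> a b; rewrite /odd_adj disjoint_sym. Qed.

Lemma odd_irr : irreflexive E.
Proof.
move=> a; rewrite /odd_adj -setI_eq0 setIid -cards_eq0 card_odd.
by apply/eqP; lia.
Qed.

Lemma odd_perm_ofE s (a : V) : val (op s a) = s @: val a.
Proof. by rewrite permE. Qed.

Lemma odd_perm_ofM : {morph op : s t / s * t}.
Proof.
move=> s t; apply/permP => a; rewrite permM; apply: val_inj.
rewrite !odd_perm_ofE -imset_comp; apply: eq_imset => x; exact: permM.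
Qed.

Lemma odd_Alt_group_set : group_set (odd_Alt d).
Proof.
have op1 : op 1 = 1 by apply: (@mulgI _ (op 1)); rewrite -odd_perm_ofM !mulg1.
apply/group_setP; split=> [|_ _ /imsetP[s sA ->] /imsetP[t tA ->]].
  by apply/imsetP; exists 1; rewrite ?group1.
by apply/imsetP; exists (s * t); rewrite ?groupM ?odd_perm_ofM.
Qed.

Definition odd_F : {group {perm V}} := Group odd_Alt_group_set.

Lemma odd_FP s : reflect (exists2 t, t \in 'Alt_('I_n) & s = op t) (s \in
  odd_F).
Proof. exact: imsetP. Qed.

Lemma odd_aut s a b : s \in odd_F -> E (s a) (s b) = E a b.
Proof. by case/odd_FP=> t _ ->; rewrite !permE odd_act_adj. Qed.

Lemma odd_vertex_of (A : {set 'I_n}) : #|A| = (d - 1)%N ->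
  exists a : V, val a = A.
Proof. by move=> /eqP cA; exists (Sub A cA); rewrite SubK. Qed.

Lemma card_compl (a : V) : #|~: val a| = d.
Proof. by have := cardsC (val a); rewrite card_odd card_ord; lia. Qed.

Lemma odd_perm_of_inj : injective op.
Proof.
move=> s t st; apply/permP => x; apply: contrapT => /eqP nst.
have [A [cA xA yA]] : exists A : {set 'I_n}, [/\ #|A| = (d - 1)%N,
  s x \in A & t x \notin A].
  have : (d - 2 <= #|~: [set s x; t x]|)%N.
    by have := cardsC [set s x; t x]; rewrite cards2 nst card_ord; lia.
  case/card_geqP => l [ul sl lB]; exists (s x |: [set y in l]); split.
  - rewrite cardsU1 cardsE (card_uniqP ul) sl inE.
    by case: (boolP (s x \in l)) => [/lB|_]; rewrite ?inE ?eqxx //; lia.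
  - by rewrite !inE eqxx.
  - rewrite !inE eq_sym (negPf nst) /=; apply/negP => /lB.
    by rewrite !inE eqxx orbT.
have [a aA] : exists a : V, val a = (s^-1)%g @: A.
  by apply: odd_vertex_of; rewrite card_imset //; exact: perm_inj.
have := congr1 (fun p : {perm V} => val (p a)) st;
  rewrite !odd_perm_ofE aA -!imset_comp.
have -> : [set (s \o (s^-1)%g) y | y in A] = A.
  by rewrite -[RHS]imset_id; apply: eq_imset => y /=; rewrite permKV.
move=> AE; have : t x \in A; last by rewrite (negPf yA).
by rewrite AE; apply/imsetP; exists (s x); rewrite //= permK.
Qed.

Local Notation fixA := (fixst E odd_F).

(** For [x] outside [a], the complement of [a] without [x] is a neighbour of [a]. A permutation
    preserving both sets fixes the one remaining point [x]. *)
Lemma odd_fixstP s a : s \in 'Alt_('I_n) -> (op s \in fixA a) = perm_on (val a)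
  s.
Proof.
move=> sA; apply/fixstP/idP => [[_ fixs]|sa].
  have fix_set b : in_star E a b -> s @: val b = val b.
    by move=> ab; rewrite -odd_perm_ofE fixs.
  have sa : s @: val a = val a by apply: fix_set; rewrite /in_star eqxx.
  apply/subsetP => x; rewrite inE; apply: contraR => xa.
  have [b bE] : exists b : V, val b = ~: val a :\ x.
    apply: odd_vertex_of; have := cardsD1 x (~: val a).
    by rewrite card_compl inE xa; lia.
  have sb : s @: val b = val b.
    apply: fix_set; rewrite /in_star; apply/orP; right.
    rewrite /odd_adj bE -setI_eq0; apply/eqP/setP => y; rewrite !inE.
    by case: (y \in val a); rewrite ?andbF.
  have sxa : s x \notin val a by rewrite -sa mem_imset //; exact: perm_inj.
  have sxb : s x \notin val b.
    by rewrite -sb mem_imset ?bE ?inE ?eqxx //; exact: perm_inj.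
  by move: sxb; rewrite bE !inE sxa andbT negbK.
split=> [|b]; first by apply/odd_FP; exists s.
case/orP=> [/eqP->|]; first by apply: val_inj; rewrite odd_perm_ofE im_perm_on.
rewrite /odd_adj disjoint_sym => ab; apply: val_inj;
  rewrite odd_perm_ofE -[RHS]imset_id.
apply: eq_in_imset => x xb; apply: (out_perm sa); by rewrite (disjointFr ab xb).
Qed.

Lemma fixst_op a s : s \in fixA a ->
  exists t, [/\ t \in 'Alt_('I_n), perm_on (val a) t & s = op t].
Proof.
move=> sa; have /fixstP[/odd_FP[t tA st] _] := sa.
by exists t; split=> //; rewrite -odd_fixstP // -st.
Qed.

Lemma odd_fixst_isog (a : V) : 'Alt_{x | x \in val a} \isog fixA a.
Proof.
pose f s := op (ext_perm (A := val a) s).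
have fM : {in setT &, {morph f : s t / s * t}}.
  by move=> s t _ _; rewrite /f ext_permM odd_perm_ofM.
pose F := Morphism fM.
have injF : 'injm F.
  by apply/injmP => s t _ _ /odd_perm_of_inj /ext_perm_inj.
have <- : F @* 'Alt_{x | x \in val a} = fixA a.
  apply/setP => s; apply/morphimP/idP => [[t _ tA ->]|].
    have etA : ext_perm t \in 'Alt_('I_n) by rewrite Alt_even odd_ext_perm
      -Alt_even.
    by rewrite /= /f odd_fixstP // ext_perm_on.
  case/fixst_op=> t [tA ta ->]; have [r rt] := ext_perm_onto ta.
  exists r; [by rewrite inE | | by rewrite /= /f rt].
  by rewrite Alt_even -odd_ext_perm rt -Alt_even.
by apply: sub_isog => //; exact: subsetT.
Qed.

Lemma card_sub (a : V) : #|{: {x | x \in val a}}| = (d - 1)%N.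
Proof. by rewrite card_sig -[RHS](card_odd a); apply: eq_card => x;
  rewrite inE. Qed.

Lemma odd_simple a : simple (fixA a).
Proof.
rewrite -(isog_simple (odd_fixst_isog a)); apply: simple_Alt5.
by rewrite card_sub; lia.
Qed.

Lemma odd_perfect a : fixA a \subset [~: fixA a, fixA a].
Proof.
have /simpleP[_ /(_ _ (der_normal 1 _))] := odd_simple a.
case=> /= e; last by rewrite -{1}e.
have /derG1P/abelian_sol := e; rewrite -(isog_sol (odd_fixst_isog a)).
by rewrite solvable_AltF // card_sub; lia.
Qed.

Lemma odd_disj a b s : E a b -> s \in fixA a -> s \in fixA b -> s = 1.
Proof.
move=> ab sa sb; have [t [tA ta st]] := fixst_op sa.
move: sb; rewrite st odd_fixstP // => tb.
suff -> : t = 1 by apply: (@mulgI _ (op 1)); rewrite -odd_perm_ofM !mulg1.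
apply/permP => x; rewrite perm1; case: (boolP (x \in val a)) => xa.
  by apply: (out_perm tb); rewrite (disjointFr ab xa).
exact: out_perm ta xa.
Qed.

Lemma perm_on_tperm (A : {set 'I_n}) x y : x \in A -> y \in A ->
  perm_on A (tperm x y).
Proof.
move=> xA yA; apply/subsetP => z; rewrite inE; apply: contraR => zA.
by rewrite tpermD //; apply: contraNneq zA => <-.
Qed.

Lemma tperm2_Alt (x y u v : 'I_n) : x != y -> u != v ->
  tperm x y * tperm u v \in 'Alt_('I_n).
Proof. by move=> xy uv; rewrite Alt_even odd_permM !odd_tperm xy uv. Qed.

(** A 3-cycle supported on [b] carries a common point of [b] and [c] to a point outside [c]. *)
Lemma odd_move b c : c != b -> ~~ E b c -> exists2 be,
  be \in fixA b & be c != c.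
Proof.
move=> cb nbc; have [x] : exists x, x \in val b :&: val c.
  by apply/set0Pn; rewrite setI_eq0.
rewrite inE => /andP[xb xc].
have [y] : exists y, y \in val b :\: val c.
  apply/set0Pn; rewrite setD_eq0; apply: contra cb => bc; rewrite eq_sym.
  by apply/eqP/val_inj/eqP; rewrite eqEcard bc !card_odd leqnn.
rewrite inE => /andP[yc yb].
have [z] : exists z, z \in val b :\: [set x; y].
  apply/set0Pn; rewrite -cards_eq0 -lt0n cardsD card_odd.
  have := subset_leq_card (subsetIr (val b) [set x; y]); have := cards2 x y.
  by case: (x != y); lia.
rewrite !inE negb_or => /andP[/andP[zx zy] zb].
have xy : x != y by apply: contraNneq yc => <-.
have sA : tperm x y * tperm x z \in 'Alt_('I_n) by apply: tperm2_Alt;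
  rewrite // eq_sym.
exists (op (tperm x y * tperm x z)).
  by rewrite odd_fixstP //; apply: perm_onM; apply: perm_on_tperm.
apply: contraNneq yc => /(congr1 val); rewrite odd_perm_ofE => <-.
by apply/imsetP; exists x; rewrite // permM tpermL tpermD // eq_sym.
Qed.

Lemma odd_sym_transitive (a b : V) : exists s : 'S_n, s @: val a = val b.
Proof.
have [m] := ubnP #|val b :\: val a|; elim: m a => // m IHm a;
  rewrite ltnS => lem.
have [/eqP|[y]] := set_0Vmem (val b :\: val a).
  rewrite setD_eq0 => ba; exists 1; rewrite imset_perm1; apply/eqP.
  by rewrite eq_sym eqEcard ba !card_odd leqnn.
rewrite inE => /andP[ya yb].
have [x] : exists x, x \in val a :\: val b.
  apply/set0Pn; rewrite setD_eq0; apply: contraNN ya => ab.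
  suff -> : val a = val b by [].
  by apply/eqP; rewrite eqEcard ab !card_odd leqnn.
rewrite inE => /andP[xb xa].
have [|s sE] := IHm (op (tperm x y) a).
  apply: leq_trans lem; apply: proper_card; apply/properP; split.
    apply/subsetP => z; rewrite !inE odd_perm_ofE => /andP[za zb];
      rewrite zb andbT.
    apply: contra za => za; apply/imsetP; exists z => //.
    by rewrite tpermD //; [apply: contraNneq xb | apply: contraNneq ya] => ->.
  exists y; first by rewrite inE ya yb.
  rewrite inE odd_perm_ofE negb_and negbK; apply/orP; left; apply/imsetP.
  by exists x; rewrite ?tpermL.
exists (tperm x y * s); rewrite -sE odd_perm_ofE -imset_comp.
by apply: eq_imset => z; rewrite permM.
Qed.

(** The parity is corrected by a transposition inside [b]. *)
Lemma odd_transitive a b : exists2 s, s \in odd_F & s a = b.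
Proof.
have [s sab] := odd_sym_transitive a b.
have [|x [y [xb yb xy]]] := @exists2_card _ (val b); first by rewrite card_odd;
  lia.
pose t := if odd_perm s then s * tperm x y else s.
exists (op t).
  apply/odd_FP; exists t => //; rewrite Alt_even /t; case: ifP => so;
    last by rewrite so.
  by rewrite odd_permM so odd_tperm xy.
apply: val_inj; rewrite odd_perm_ofE /t; case: ifP => // _.
have -> : (s * tperm x y) @: val a = tperm x y @: (s @: val a).
  by rewrite -imset_comp; apply: eq_imset => z; rewrite permM.
by rewrite sab im_perm_on // perm_on_tperm.
Qed.

Lemma imset_permM (s t : 'S_n) (A : {set 'I_n}) : (s * t) @: A = t @: (s @: A).
Proof. by rewrite -imset_comp; apply: eq_imset => z; rewrite permM. Qed.

Lemma imset_fix (s : 'S_n) (A : {set 'I_n}) : {in A, forall x, s x = x} ->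
  s @: A = A.
Proof. by move=> sA; rewrite -[RHS]imset_id; apply: eq_in_imset. Qed.

Lemma tperm_notin (A : {set 'I_n}) x y : x \notin A -> y \notin A ->
  {in A, forall z, tperm x y z = z}.
Proof.
move=> xA yA z zA; rewrite tpermD //; [apply: contraNneq xA|apply: contraNneq
  yA];
  by move->.
Qed.

(* The witness is a product of transpositions of [val b :\: val a] and of the *)
(* complement of [val a :|: val b]: it fixes [val a] pointwise and is odd on  *)
(* [val b].                                                                   *)
Lemma odd_separated (a b : V) (x y u v : 'I_n) :
    x \in val b :\: val a -> y \in val b :\: val a -> x != y ->
    u \notin val a :|: val b -> v \notin val a :|: val b -> u != v ->
  separated_labels E odd_F a b.
Proof.
rewrite !inE !negb_or => /andP[xa xb] /andP[ya yb] xy /andP[ua ub] /andP[va vb]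
  uv.
have sA := tperm2_Alt xy uv; set s := tperm x y * tperm u v in sA.
have xy_on : perm_on (val b) (tperm x y) by exact: perm_on_tperm.
have s_off : perm_on (~: val a) s.
  by apply: perm_onM; apply: perm_on_tperm; rewrite inE.
exists (op s); split.
- by apply/odd_FP; exists s.
- apply: val_inj; rewrite odd_perm_ofE imset_fix // => z za.
  by apply: (out_perm s_off); rewrite inE za.
- apply: val_inj; rewrite odd_perm_ofE imset_permM (im_perm_on xy_on) imset_fix
  //.
  exact: tperm_notin.
- move=> _ /fixst_op[t [tA ta ->]]; rewrite /commute -!odd_perm_ofM; congr op.
  apply: (perm_onC s_off ta).
  by rewrite -setI_eq0 setIC setICr.
move=> _ /fixst_op[r [rA rb ->]].
(* On [b] the product [r * s] is the odd permutation [f], so it moves some [p] to [q]; a 3-cycle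
   through [q] that fixes [p] does not commute with it. *)
pose f := r * tperm x y; have f_on : perm_on (val b) f by exact: perm_onM.
have [p fp] : exists p, f p != p.
  apply/existsP; apply: contraT; rewrite negb_exists => /forallP f1.
  have : odd_perm f by rewrite odd_permM odd_tperm xy -(negbK (odd_perm r))
    -Alt_even rA.
  suff -> : f = 1 by rewrite odd_perm1.
  by apply/permP => z; rewrite perm1; apply/eqP; move: (f1 z); rewrite negbK.
have pb : p \in val b by apply: contraNT fp => pb; rewrite (out_perm f_on).
pose q := f p; have qb : q \in val b by rewrite (perm_closed _ f_on).
have : (1 < #|val b :\: [set p; q]|)%N.
  have le2 : (#|val b :&: [set p; q]| <= 2)%N.
    apply: leq_trans (subset_leq_card (subsetIr _ _)) _.
    by rewrite cards2; apply: (leq_add (leqnn 1)); exact: leq_b1.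
  by rewrite cardsD card_odd; move: #|_ :&: _| le2 hd; clear; move=> m; lia.
case/exists2_card=> z [w []]; rewrite !inE !negb_or.
move=> /andP[/andP[zp zq] zb] /andP[/andP[wp wq] wb] zw.
have gA : tperm q z * tperm q w \in 'Alt_('I_n) by apply: tperm2_Alt;
  rewrite eq_sym.
exists (op (tperm q z * tperm q w)).
  by rewrite odd_fixstP //; apply: perm_onM; apply: perm_on_tperm.
rewrite /commute -!odd_perm_ofM => /odd_perm_of_inj /permP/(_ p).
have uv_b t : t \in val b -> tperm u v t = t by exact: tperm_notin.
have rsE t : t \in val b -> (r * s) t = f t.
  move=> tb; rewrite /s mulgA permM -/f uv_b //.
  by rewrite (perm_closed _ f_on).
have gq : (tperm q z * tperm q w) q = z.
  by rewrite permM tpermL tpermD // eq_sym.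
have gp : (tperm q z * tperm q w) p = p by rewrite permM (@tpermD _ q z) //
  tpermD.
rewrite permM rsE // -/q gq [X in _ = X]permM gp rsE // -/q => zqE.
by rewrite zqE eqxx in zq.
Qed.

Section Independence.
Variable R : V -> V -> Prop.
Hypotheses (R_sym : forall a b, R a b -> R b a)
  (R_trans : forall a b c, R a b -> R b c -> R a c)
  (R_inv : forall s a b, s \in odd_F -> R a b -> R (s a) (s b))
  (R_sep : forall a b, separated_labels E odd_F a b -> ~ R a b).

(* The pairs for which [odd_separated] fails are replaced with others by      *)
(* means of permutations that preserve [a] and move [b].                      *)
Lemma indep_move (a b : V) s : s \in 'Alt_('I_n) -> s @: val a = val a ->
  R a b ->
  R b (op s b).
Proof.
move=> sA sa ab; apply: R_trans (R_sym ab) _.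
have {1}<- : op s a = a by apply: val_inj; rewrite odd_perm_ofE.
by apply: R_inv ab; apply/odd_FP; exists s.
Qed.

(** Exchange [x] with [x'] inside [a], and [y] with [y'] outside it. The image of [b] gains [x] and
    [y'], while [u] and [v] stay outside both sets, so [b] and its image are separated. *)
Lemma indep_close (a b : V) : #|val b :\: val a| = 1%N -> ~ R a b.
Proof.
move=> ba1 ab; have IabC : val b :&: val a = val a :&: val b by exact: setIC.
have cab : #|val a :&: val b| = (d - 2)%N.
  by have := cardsID (val a) (val b); rewrite card_odd ba1 IabC; lia.
have [x] : exists x, x \in val a :\: val b.
  apply/set0Pn; rewrite -cards_eq0 -lt0n.
  by have := cardsID (val b) (val a); rewrite card_odd cab; lia.
have [y] : exists y, y \in val b :\: val a.
  by apply/set0Pn; rewrite -cards_eq0 ba1.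
have [x'] : exists x', x' \in val a :&: val b.
  by apply/set0Pn; rewrite -cards_eq0 cab; apply/eqP; lia.
rewrite !inE => /andP[xa' xb'] /andP[ya yb] /andP[xb xa].
have : (2 < #|~: (val a :|: val b)|)%N.
  have := cardsC (val a :|: val b); rewrite cardsU !card_odd cab card_ord; lia.
case/card_gt2P=> y' [u [v [[]]]]; rewrite !inE !negb_or.
move=> /andP[ya' yb'] /andP[ua ub] /andP[va vb] [yu uv vy].
have neq_in (A : {set 'I_n}) p q : p \in A -> q \notin A -> p != q.
  by move=> pA; apply: contraNneq => <-.
have xx' : x != x' by rewrite eq_sym (neq_in _ _ _ xb').
have yy' : y != y' by exact: (neq_in _ _ _ yb yb').
have sA := tperm2_Alt xx' yy'; set s := tperm x x' * tperm y y' in sA.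
have sa : s @: val a = val a.
  by rewrite imset_permM (im_perm_on (perm_on_tperm xa xa')) (imset_fix
    (tperm_notin ya ya')).
apply: (R_sep _ (indep_move sA sa ab)).
have sx' : s x' = x.
  by rewrite permM tpermR tpermD // eq_sym; [exact: (neq_in _ _ _ xa ya) |
    exact: (neq_in _ _ _ xa ya')].
have sy : s y = y'.
  rewrite permM (@tpermD _ x x') ?tpermL //; first exact: (neq_in _ _ _ xa ya).
  exact: (neq_in _ _ _ xa' ya).
have s_out t : t \notin val a -> t != y -> t != y' -> s t = t.
  move=> ta ty ty'; rewrite permM (@tpermD _ x x').
  - by rewrite tpermD // eq_sym.
  - exact: (neq_in _ _ _ xa ta).
  - exact: (neq_in _ _ _ xa' ta).
have notin t : t \notin val a -> t \notin val b -> t != y' ->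
  t \notin val b :|: val (op s b).
  move=> ta tb ty'; rewrite inE negb_or tb odd_perm_ofE.
  by rewrite -(s_out t) ?mem_imset //; [exact: perm_inj |
    rewrite eq_sym (neq_in _ _ _ yb)].
apply: (@odd_separated b (op s b) x y' u v); rewrite ?odd_perm_ofE.
- by rewrite inE xb -sx' imset_f.
- by rewrite inE yb' -sy imset_f.
- exact: (neq_in _ _ _ xa ya').
- by rewrite -odd_perm_ofE notin // eq_sym.
- by rewrite -odd_perm_ofE notin.
- by [].
Qed.

Lemma odd_indep a b : R a b -> a = b.
Proof.
move=> ab; apply: contrapT => nab; have {nab} nab : val a != val b.
  by apply/eqP => /val_inj.
have cU := cardsU (val a) (val b); have cI := cardsID (val a) (val b).
have IabC : val b :&: val a = val a :&: val b by exact: setIC.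
rewrite !card_odd IabC in cU cI.
have cC := cardsC (val a :|: val b); rewrite card_ord in cC.
have ba0 : (0 < #|val b :\: val a|)%N.
  rewrite lt0n cards_eq0 setD_eq0; apply: contra nab => sba.
  by rewrite eq_sym eqEcard sba !card_odd leqnn.
case: (ltngtP #|val b :\: val a| 1%N) => [|gt1|/indep_close/(_ ab)//];
  first by rewrite ltnS leqNgt ba0.
have [x [y [xba yba xy]]] := exists2_card gt1.
have a_gt1 : (1 < #|val a|)%N by rewrite card_odd; move: hd; clear; lia.
(* The complement of the union has one point more than the intersection, so in the remaining case
   [a] and [b] are disjoint and miss a single [z]. Exchanging [z] with a point of [b] leads to
   [indep_close]. *)
have few (k m i c : nat) : i + k = (d - 1)%N -> m = (d - 1 + (d - 1) - i)%N ->
    m + c = (2 * d - 1)%N -> c <= 1 -> i = 0%N /\ c = 1%N.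
  by move: hd; clear; lia.
case: (leqP #|~: (val a :|: val b)| 1) => [le1|/exists2_card[u [v [ul vl uv]]]];
  last first.
  by apply: (R_sep _ ab); apply: odd_separated xba yba xy _ _ uv;
    rewrite -in_setC.
have [/eqP] := few _ _ _ _ cI cU cC le1; rewrite cards_eq0 => /eqP I0 c1.
have [z] : exists z, z \in ~: (val a :|: val b).
  by apply/set0Pn; rewrite -cards_eq0 c1.
rewrite !inE negb_or => /andP[za zb].
have [u [v [ua va uv]]] := exists2_card a_gt1.
have nb t : t \in val a -> t \notin val b.
  by move=> ta; apply/negP => tb; have := in_set0 t; rewrite -I0 inE ta tb.
move: xba; rewrite inE => /andP[xa xb].
have xz : x != z by apply: contraNneq zb => <-.
have sA := tperm2_Alt xz uv; set s := tperm x z * tperm u v in sA.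
have sa : s @: val a = val a.
  rewrite imset_permM (imset_fix (tperm_notin xa za)) im_perm_on //.
  exact: perm_on_tperm.
apply: (indep_close _ (indep_move sA sa ab)).
suff -> : val (op s b) :\: val b = [set z] by rewrite cards1.
have uvz : tperm u v z = z.
  by rewrite tpermD //; [apply: contraNneq za => <- |
    apply: contraNneq za => <-].
apply/setP => t; rewrite !inE odd_perm_ofE; apply/andP/eqP => [[tb /imsetP[w wb
  tE]]|->].
  case: (eqVneq w x) => [wx|wx]; first by rewrite tE wx permM tpermL uvz.
  have wz : z != w by apply: contraNneq zb => ->.
  move: tb; rewrite tE permM (@tpermD _ x z) // 1?eq_sym //.
  by rewrite (tperm_notin (nb u ua) (nb v va)) // wb.
by split=> //; apply/imsetP; exists x; rewrite // permM tpermL uvz.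
Qed.

End Independence.

Lemma odd_far_pair : exists a b : V, b != a /\ ~~ E a b.
Proof.
have : (d - 1 <= #|[set: 'I_n]|)%N by rewrite cardsT card_ord; lia.
case/card_geqP=> l [ul sl _].
have [a aE] : exists a : V, val a = [set x in l].
  by apply: odd_vertex_of; rewrite cardsE (card_uniqP ul).
have [|x [w [xa wa xw]]] := @exists2_card _ (val a); first by rewrite card_odd;
  lia.
have [y] : exists y, y \in ~: val a.
  by apply/set0Pn; rewrite -cards_eq0 card_compl; apply/eqP; lia.
rewrite inE => ya; exists a, (op (tperm x y) a).
have yb : y \in val (op (tperm x y) a).
  by rewrite odd_perm_ofE; apply/imsetP; exists x; rewrite ?tpermL.
split; first by apply: contraNneq ya => ba; rewrite -{1}ba.
rewrite /odd_adj -setI_eq0; apply/set0Pn; exists w; rewrite inE wa odd_perm_ofE.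
by apply/imsetP; exists w; rewrite // tpermD //; apply: contraNneq ya => ->.
Qed.

End OddGraphGroup.

Local Open Scope classical_set_scope.

Theorem theoremB (d : nat) (hd : (6 <= d)%N)
    (G : set (racg (@odd_adj d) -> racg (@odd_adj d))) :
  let U := universal_group (E := @odd_adj d) (odd_Alt d) in
  is_subgroup G -> G `<=` U -> is_transitive G ->
  [<-> is_dense_in G U;
       ~ is_discrete G /\
       exists v, restriction (stabilizer G v) (linf_ball 1 v) =
                 restriction (stabilizer U v) (linf_ball 1 v);
       exists v, restriction (stabilizer G v) (linf_ball 2 v) =
                 restriction (stabilizer U v) (linf_ball 2 v)].
Proof.
move=> U Gsub GU Gtr; have [a [b [ba nab]]] := odd_far_pair hd.
exact: (dense_tfae (@odd_sym d) (odd_irr hd) (F := odd_F d) (@odd_aut d)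
  (@odd_disj d hd) (odd_perfect hd) Gsub GU (@odd_move d hd) Gtr (odd_simple hd)
  (odd_transitive hd) (@odd_indep d hd) ba nab).
Qed.
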